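(* Let $p$ be a prime ($p=2$ allowed) and let $G$ be a finite $p$-group with $d(G)=3$, $\Phi(G)\le Z(G)$ and $G'\cong C_p^3$. Suppose the type of $G/G'$ is $(p^{m_1},p^{m_2},p^{m_3})$ with $m_1>m_2>m_3$. Then one can choose suitable (characteristic) generators of $G$ such that the characteristic matrix of $G$ is one of the following matrices, and different matrices give non-isomorphic groups. Here $\nu,\nu_1,\nu_2\in\{1,\eta\}$ and $t\in F_p$, $t\neq 0$. (A1) $e_{11}+\nu_1e_{22}+\nu_2e_{33}$; (A2) $e_{11}+e_{23}+te_{32}$; (A3) $te_{13}+e_{22}+e_{31}$; (A4) $e_{13}+e_{21}+e_{32}$; (A5) $e_{12}+e_{23}+e_{31}$; (A6) $te_{12}+e_{21}+e_{33}$; (B1) $e_{11}+\nu e_{22}$; (B2) $e_{11}+e_{23}$; (B3) $e_{13}+e_{22}$; (B4) $e_{12}+e_{23}$; (B5) $e_{13}+e_{32}$; (B6) $e_{11}+\nu e_{33}$; (B7) $e_{11}+e_{32}$; (B8) $e_{12}+e_{33}$; (B9) $e_{22}+e_{31}$; (B10) $e_{23}+e_{31}$; (B11) $e_{21}+e_{33}$; (B12) $e_{21}+e_{32}$; (B13) $e_{12}+e_{31}$; (B14) $te_{13}+e_{31}$; (B15) $e_{13}+e_{21}$; (B16) $te_{12}+e_{21}$; (B17) $e_{22}+\nu e_{33}$; (B18) $e_{23}+te_{32}$; (C1) $e_{11}$; (C2) $e_{12}$; (C3) $e_{13}$; (C4) $e_{21}$; (C5) $e_{22}$; (C6) $e_{23}$;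 (C7) $e_{33}$; (C8) $e_{32}$; (C9) $e_{31}$; (C10) $0$.
   Context: $d(G)$ is the minimal number of generators of $G$, $\Phi(G)$ the Frattini subgroup, $G'$ the derived subgroup, $C_p^3$ the elementary abelian group of order $p^3$. $F_p$ is the field with $p$ elements. For odd $p$, $\eta$ is a fixed square non-residue modulo $p$; for $p=2$ parameters ranging over $\{1,\eta\}$ are equal to $1$. $e_{ij}$ denotes the $3\times3$ matrix over $F_p$ with $1$ in position $(i,j)$ and $0$ elsewhere. Characteristic matrix: let $G$ be a finite $p$-group with $d(G)=3$, $\Phi(G)\le Z(G)$, $G'\cong C_p^3$, and $G/G'$ of type $(p^{m_1},p^{m_2},p^{m_3})$, $m_1\ge m_2\ge m_3\ge1$ (i.e. $G/G'\cong C_{p^{m_1}}\times C_{p^{m_2}}\times C_{p^{m_3}}$). Choose $a_1,a_2,a_3\in G$ with $G/G'=\langle a_1G'\rangle\times\langle a_2G'\rangle\times\langle a_3G'\rangle$, $o(a_iG')=p^{m_i}$. Then $G=\langle a_1,a_2,a_3\rangle$, and $G'=\langle x,y,z\rangle$ with $x=[a_2,a_3]$, $y=[a_3,a_1]$, $z=[a_1,a_2]$. Write $a_i^{p^{m_i}}=x^{w_{i1}}y^{w_{i2}}z^{w_{i3}}$ for $i=1,2,3$. The $3\times3$ matrix $w(G)=(w_{ij})$ over $F_p$ is called a characteristic matrix of $G$, and $a_1,a_2,a_3$ a set of characteristic generators about $w(G)$ (the matrix depends on the choice of generators). A characteristic matrix together with $p,m_1,m_2,m_3$ determines $G$ up to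 isomorphism. *)

(* Defs.v *)
From HB Require Import structures.
From mathcomp Require Import all_boot all_order all_algebra.
From mathcomp Require Import all_fingroup all_solvable.

Set Implicit Arguments.
Unset Strict Implicit.
Unset Printing Implicit Defensive.

Import GRing.Theory.

Local Open Scope group_scope.

(* [abelian_type] lists the invariants in decreasing order, so the last clause
   says that G / G' is the direct product of cyclic groups of orders p ^ m1,
   p ^ m2 and p ^ m3. *)
Definition group_class (p m1 m2 m3 : nat) (gT : finGroupType)
    (G : {group gT}) : Prop :=
  [/\ p.-group G,
      'm(G) = 3,
      'Phi(G) \subset 'Z(G),
      p.-abelem G^`(1) /\ #|G^`(1)| = (p ^ 3)%N
    & abelian_type (G / G^`(1)) = [:: (p ^ m1)%N; (p ^ m2)%N; (p ^ m3)%N]].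

Definition char_gens (p m1 m2 m3 : nat) (gT : finGroupType) (G : {group gT})
    (a1 a2 a3 : gT) : Prop :=
  [/\ [/\ a1 \in G, a2 \in G & a3 \in G],
      <[coset G^`(1) a1]> \x <[coset G^`(1) a2]> \x <[coset G^`(1) a3]>
        = G / G^`(1)
    & [/\ #[coset G^`(1) a1] = (p ^ m1)%N, #[coset G^`(1) a2] = (p ^ m2)%N
        & #[coset G^`(1) a3] = (p ^ m3)%N]].

(* The exponents in 'F_p are read as natural numbers below p; this is harmless
   as x, y, z lie in G', which has exponent p. Indices are 1-based, as in
   [e_ p i j] below. *)
Definition row_word (p : nat) (gT : finGroupType) (w : 'M['F_p]_3) (i : nat)
    (x y z : gT) : gT :=
  let exp j := nat_of_ord (w (inord i.-1) (inord j.-1)) in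
  x ^+ exp 1%N * y ^+ exp 2%N * z ^+ exp 3%N.

(* w is the characteristic matrix with respect to a1, a2, a3. *)
Definition char_matrix_of (p m1 m2 m3 : nat) (gT : finGroupType)
    (a1 a2 a3 : gT) (w : 'M['F_p]_3) : Prop :=
  let x := [~ a2, a3] in let y := [~ a3, a1] in let z := [~ a1, a2] in
  [/\ a1 ^+ (p ^ m1) = row_word w 1 x y z,
      a2 ^+ (p ^ m2) = row_word w 2 x y z
    & a3 ^+ (p ^ m3) = row_word w 3 x y z].

Arguments char_matrix_of p m1 m2 m3 {gT} a1 a2 a3 w.

Definition char_matrix (p m1 m2 m3 : nat) (gT : finGroupType) (G : {group gT})
    (w : 'M['F_p]_3) : Prop :=
  exists a1 a2 a3 : gT,
    char_gens p m1 m2 m3 G a1 a2 a3 /\ char_matrix_of p m1 m2 m3 a1 a2 a3 w.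
Arguments char_matrix p m1 m2 m3 {gT} G w.

Local Open Scope ring_scope.

Definition e_ (p i j : nat) : 'M['F_p]_3 := delta_mx (inord i.-1) (inord j.-1).

Definition nonresidue (p : nat) (eta : 'F_p) : Prop :=
  forall u : 'F_p, u ^+ 2 <> eta.

(* For p = 2 there is no nonresidue, and the parameter can only be 1. *)
Definition is_nu (p : nat) (eta nu : 'F_p) : Prop :=
  nu = 1 \/ odd p /\ nu = eta.

Inductive canonical_matrix (p : nat) (eta : 'F_p) : 'M['F_p]_3 -> Prop :=
| A1 nu1 nu2 : is_nu eta nu1 -> is_nu eta nu2 ->
    canonical_matrix eta (e_ p 1 1 + nu1 *: e_ p 2 2 + nu2 *: e_ p 3 3)
| A2 t : t != 0 -> canonical_matrix eta (e_ p 1 1 + e_ p 2 3 + t *: e_ p 3 2)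
| A3 t : t != 0 -> canonical_matrix eta (t *: e_ p 1 3 + e_ p 2 2 + e_ p 3 1)
| A4 : canonical_matrix eta (e_ p 1 3 + e_ p 2 1 + e_ p 3 2)
| A5 : canonical_matrix eta (e_ p 1 2 + e_ p 2 3 + e_ p 3 1)
| A6 t : t != 0 -> canonical_matrix eta (t *: e_ p 1 2 + e_ p 2 1 + e_ p 3 3)
| B1 nu : is_nu eta nu -> canonical_matrix eta (e_ p 1 1 + nu *: e_ p 2 2)
| B2 : canonical_matrix eta (e_ p 1 1 + e_ p 2 3)
| B3 : canonical_matrix eta (e_ p 1 3 + e_ p 2 2)
| B4 : canonical_matrix eta (e_ p 1 2 + e_ p 2 3)
| B5 : canonical_matrix eta (e_ p 1 3 + e_ p 3 2)
| B6 nu : is_nu eta nu -> canonical_matrix eta (e_ p 1 1 + nu *: e_ p 3 3)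
| B7 : canonical_matrix eta (e_ p 1 1 + e_ p 3 2)
| B8 : canonical_matrix eta (e_ p 1 2 + e_ p 3 3)
| B9 : canonical_matrix eta (e_ p 2 2 + e_ p 3 1)
| B10 : canonical_matrix eta (e_ p 2 3 + e_ p 3 1)
| B11 : canonical_matrix eta (e_ p 2 1 + e_ p 3 3)
| B12 : canonical_matrix eta (e_ p 2 1 + e_ p 3 2)
| B13 : canonical_matrix eta (e_ p 1 2 + e_ p 3 1)
| B14 t : t != 0 -> canonical_matrix eta (t *: e_ p 1 3 + e_ p 3 1)
| B15 : canonical_matrix eta (e_ p 1 3 + e_ p 2 1)
| B16 t : t != 0 -> canonical_matrix eta (t *: e_ p 1 2 + e_ p 2 1)
| B17 nu : is_nu eta nu -> canonical_matrix eta (e_ p 2 2 + nu *: e_ p 3 3)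
| B18 t : t != 0 -> canonical_matrix eta (e_ p 2 3 + t *: e_ p 3 2)
| C1 : canonical_matrix eta (e_ p 1 1)
| C2 : canonical_matrix eta (e_ p 1 2)
| C3 : canonical_matrix eta (e_ p 1 3)
| C4 : canonical_matrix eta (e_ p 2 1)
| C5 : canonical_matrix eta (e_ p 2 2)
| C6 : canonical_matrix eta (e_ p 2 3)
| C7 : canonical_matrix eta (e_ p 3 3)
| C8 : canonical_matrix eta (e_ p 3 2)
| C9 : canonical_matrix eta (e_ p 3 1)
| C10 : canonical_matrix eta 0.

(* Main.v *)
Require Import Defs.
From mathcomp Require Import all_boot all_order all_algebra.
From mathcomp Require Import all_fingroup all_solvable.
From mathcomp Require Import finfield mxabelem ring.

(* Because m1 > m2 > m3, a second set of characteristic generators is related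
   to the first one by a matrix C that is upper triangular modulo p, while the
   vectors of p ^ m_i-th powers are related by a lower triangular matrix D with
   the same diagonal as C, the entries off the diagonals being arbitrary. The
   commutators x, y, z transform by the cofactor matrix of C, so the
   characteristic matrices w and v satisfy v adj(L) = D w with L the transpose
   of C, that is, det(L) v = D w L. Elimination by lower triangular matrices on
   both sides leaves a partial permutation pattern, which is an invariant, with
   nonzero entries on which the common diagonal (c_1, c_2, c_3) acts by
   c_i c_j / (c_1 c_2 c_3). Normalizing these entries gives the list: symmetric
   pairs of positions leave a ratio t, diagonal positions leave ratios up to
   squares. *)

Set Implicit Arguments.
Unset Strict Implicit.
Unset Printing Implicit Defensive.

Import GRing.Theory.
Local Open Scope ring_scope.

(** * Lower triangular equivalence of matrices *)

Definition partial_monomial (F : fieldType) (n : nat) (A : 'M[F]_n) : Prop :=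
  (forall i j l, A i j != 0 -> A i l != 0 -> j = l) /\
  (forall i k j, A i j != 0 -> A k j != 0 -> i = k).

Definition unitri (F : fieldType) (n : nat) (A : 'M[F]_n) : Prop :=
  (forall i j : 'I_n, (i < j)%N -> A i j = 0) /\ (forall i, A i i = 1).

Lemma trig_mulmx_diag (R : pzRingType) (n : nat) (A B : 'M[R]_n) :
  (forall i j : 'I_n, (i < j)%N -> A i j = 0) ->
  (forall i j : 'I_n, (i < j)%N -> B i j = 0) ->
  (forall i j : 'I_n, (i < j)%N -> (A *m B) i j = 0) /\
  (forall i, (A *m B) i i = A i i * B i i).
Proof.
move=> tA tB; split=> [i j ltij|i].
  rewrite mxE big1 // => k _; have [ltik|leki] := ltnP i k.
    by rewrite tA ?mul0r.
  by rewrite tB ?mulr0 // (leq_ltn_trans leki).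
rewrite mxE (bigD1 i) //= big1 ?addr0 // => k; rewrite neq_ltn => /orP[] lt.
  by rewrite tB ?mulr0.
by rewrite tA ?mul0r.
Qed.

Lemma unitri_mul (F : fieldType) (n : nat) (A B : 'M[F]_n) :
  unitri A -> unitri B -> unitri (A *m B).
Proof.
move=> [tA dA] [tB dB]; have [tAB dAB] := trig_mulmx_diag tA tB.
by split=> // i; rewrite dAB dA dB mulr1.
Qed.

Lemma unitri1 (F : fieldType) (n : nat) : unitri (1%:M : 'M[F]_n).
Proof.
split=> [i j ltij|i]; rewrite mxE ?eqxx //.
by case: eqP ltij => // ->; rewrite ltnn.
Qed.

(** Multiples of row [i0] are subtracted from the rows below it, and multiples of column [j0] from
    the columns to its left; both operations are lower unitriangular. The entries above the pivot
    and to its right already vanish, so the pivot becomes alone in its row and column, and the other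
    rows show the Schur complement. *)
Lemma unitri_clear_row (F : fieldType) (n : nat) (A : 'M[F]_n) (i0 j0 : 'I_n) :
    A i0 j0 != 0 -> (forall i : 'I_n, (i < i0)%N -> A i j0 = 0) ->
    (forall j : 'I_n, (j0 < j)%N -> A i0 j = 0) ->
  exists D L : 'M[F]_n, [/\ unitri D, unitri L &
    D *m A *m L = \matrix_(i, j)
      (if i == i0 then if j == j0 then A i0 j0 else 0
       else A i j - A i j0 * A i0 j / A i0 j0)].
Proof.
move=> nzA upA rightA.
pose u : 'cV[F]_n := \col_i (if (i0 < i)%N then A i j0 / A i0 j0 else 0).
pose v : 'rV[F]_n := \row_j (if (j < j0)%N then A i0 j / A i0 j0 else 0).
exists (1%:M - u *m delta_mx 0 i0), (1%:M - delta_mx j0 0 *m v).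
have uE i j : (u *m delta_mx 0 i0) i j = if j == i0 then u i 0 else 0.
  rewrite mxE big_ord1 [delta_mx _ _ _ _]mxE eqxx /=.
  by case: eqP; rewrite ?mulr1 ?mulr0.
have vE i j : (delta_mx j0 0 *m v) i j = if i == j0 then v 0 j else 0.
  rewrite mxE big_ord1 [delta_mx _ _ _ _]mxE eqxx andbT.
  by case: eqP; rewrite ?mul1r ?mul0r.
have mxB (X Y : 'M[F]_n) i j : (X - Y) i j = X i j - Y i j by rewrite !mxE.
split.
- split=> [i j ltij|i]; rewrite mxB uE [1%:M _ _]mxE.
    case: eqP ltij => [->|_]; rewrite ?ltnn // => ltij.
    by case: eqP ltij => [->|_] lt; rewrite ?subr0 // mxE ltnNge ltnW ?subr0.
  by rewrite eqxx; case: eqP => [->|_]; rewrite ?mxE ?ltnn subr0.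
- split=> [i j ltij|i]; rewrite mxB vE [1%:M _ _]mxE.
    case: eqP ltij => [->|_]; rewrite ?ltnn // => ltij.
    by case: eqP ltij => [->|_] lt; rewrite ?subr0 // mxE ltnNge ltnW ?subr0.
  by rewrite eqxx; case: eqP => [->|_]; rewrite ?mxE ?ltnn subr0.
have -> : (1%:M - u *m delta_mx 0 i0) *m A = A - u *m row i0 A.
  by rewrite mulmxBl mul1mx -mulmxA -rowE.
rewrite mulmxBr mulmx1 mulmxA -colE; apply/matrixP=> i j.
rewrite !mxE !big_ord1 !mxE big_ord1 !mxE.
case: (ltngtP i i0) => [lt|lt|/val_inj->].
- have /negPf-> : i != i0 by rewrite neq_ltn lt.
  by rewrite (upA i lt) !mul0r !subr0 mul0r !subr0.
- have /negPf-> : i != i0 by rewrite neq_ltn lt orbT.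
  by field.
rewrite eqxx; case: (ltngtP j j0) => [lt|lt|/val_inj->].
- have /negPf-> : j != j0 by rewrite neq_ltn lt.
  by field.
- have /negPf-> : j != j0 by rewrite neq_ltn lt orbT.
  by rewrite (rightA j lt) !mul0r mulr0 !subr0.
by rewrite eqxx; ring.
Qed.

(* Gaussian elimination, row by row from the top; the pivot of a row is its
   rightmost nonzero entry. *)
Lemma unitri_partial_monomial (F : fieldType) (n : nat) (A : 'M[F]_n) :
  exists D L : 'M[F]_n,
    [/\ unitri D, unitri L & partial_monomial (D *m A *m L)].
Proof.
(* The index [r] runs over all rows, so the pivot columns of the first [k] rows are cleared further
   down as well. *)
pose clean k (B : 'M[F]_n) := forall i : 'I_n, (i < k)%N ->
  (forall j l, B i j != 0 -> B i l != 0 -> j = l) /\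
  (forall r j, B i j != 0 -> B r j != 0 -> i = r).
suff: forall k, (k <= n)%N ->
    exists D L : 'M[F]_n, [/\ unitri D, unitri L & clean k (D *m A *m L)].
  case/(_ n (leqnn n)) => D [L [uD uL cl]]; exists D, L; split=> //; split.
    by move=> i; have [] := cl i (ltn_ord i).
  by move=> i k j; have [_] := cl i (ltn_ord i); apply.
elim=> [|k IHk] ltkn; first by exists 1%:M, 1%:M; split=> //; exact: unitri1.
have [D [L [uD uL]]] := IHk (ltnW ltkn); set B := D *m A *m L => clB.
pose i0 := Ordinal ltkn; case: (pickP (fun j => B i0 j != 0)) => [j1 nzj1|z].
  case: (@arg_maxnP _ j1 (fun j => B i0 j != 0) (@nat_of_ord n) nzj1) => j0 nz0 maxj.
  have [||D' [L' [uD' uL' E]]] := unitri_clear_row nz0.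
  - move=> i lti; apply/eqP/negPn/negP=> nzi.
    have [_ /(_ i0 j0 nzi nz0) ii] := clB i lti.
    by rewrite ii ltnn in lti.
  - by move=> j ltj; apply/eqP; apply: contraTT ltj => /maxj; rewrite -leqNgt.
  exists (D' *m D), (L *m L'); split; try exact: unitri_mul.
  have -> : D' *m D *m A *m (L *m L') = D' *m B *m L' by rewrite /B !mulmxA.
  have {}E r l := congr1 (fun C : 'M_n => C r l) E.
  move=> i; rewrite ltnS leq_eqVlt => /orP[/eqP ik|ltik].
    have {ik}->: i = i0 by apply: val_inj.
    split=> [j l|r j]; rewrite !E ![(\matrix_(_, _) _) _ _]mxE eqxx.
      case: (j =P j0) => [->|]; last by rewrite eqxx.
      by case: (l =P j0) => [->|]; rewrite ?eqxx.
    case: (j =P j0) => [->|]; last by rewrite eqxx.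
    by move=> _; case: (r =P i0) => [->//|_]; rewrite mulfK // subrr eqxx.
  (* The earlier rows vanish in column [j0] and hence do not change; row [i0] vanishes in their
     pivot columns, so these stay clean. *)
  have [rowi coli] := clB i ltik.
  have nei: i != i0 by rewrite neq_ltn ltik.
  have Bi0 : B i j0 = 0.
    by apply/eqP; apply: contraNT nei => nz; rewrite (coli i0 j0 nz nz0).
  split=> [j l|r j]; rewrite !E ![(\matrix_(_, _) _) _ _]mxE (negPf nei) Bi0
    !mul0r !subr0.
    exact: rowi.
  move=> nzj; have Bj : B i0 j = 0.
    by apply/eqP; apply: contraNT nei => nz; rewrite (coli i0 j nzj nz).
  rewrite Bj mulr0 mul0r subr0; case: (r =P i0) => [->|_]; last exact: coli.
  case: (j =P j0) => [jj|]; last by rewrite eqxx.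
  by rewrite jj Bi0 eqxx in nzj.
exists D, L; split=> // i; rewrite ltnS leq_eqVlt => /orP[/eqP ik|]; last exact: clB.
have {ik}->: i = i0 by apply: val_inj.
by split=> [j l|r j]; rewrite -/B z.
Qed.

(* Induction on the row index: the pivots of A in row i can only move to a
   higher row of B, where by induction A already has a pivot. *)
Lemma trig_partial_monomial_inj (F : fieldType) (n : nat)
    (A B M D : 'M[F]_n) :
    partial_monomial A -> partial_monomial B ->
    (forall i j : 'I_n, (i < j)%N -> M i j = 0) -> (forall i, M i i != 0) ->
    (forall i j : 'I_n, (i < j)%N -> D i j = 0) -> (forall i, D i i != 0) ->
    A *m M = D *m B ->
  forall i j, A i j * M j j = D i i * B i j.
Proof.
move=> [rA cA] [rB cB] tM dM tD dD E.
have AM i j : A i j != 0 -> (A *m M) i j = A i j * M j j.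
  move=> nz; rewrite mxE (bigD1 j) //= big1 ?addr0 // => l nel.
  have [->|nz'] := eqVneq (A i l) 0; first by rewrite mul0r.
  by rewrite (rA _ _ _ nz nz') eqxx in nel.
have DB i j : B i j != 0 -> (D *m B) i j = D i i * B i j.
  move=> nz; rewrite mxE (bigD1 i) //= big1 ?addr0 // => l nel.
  have [->|nz'] := eqVneq (B l j) 0; first by rewrite mulr0.
  by rewrite (cB _ _ _ nz nz') eqxx in nel.
have supp k : forall i : 'I_n, (i < k)%N -> forall j, (A i j != 0) = (B i j != 0).
  elim: k => // k IHk i; rewrite ltnS => leik j.
  have sAB l : A i l != 0 -> B i l != 0.
    move=> nz; have : (D *m B) i l != 0 by rewrite -E AM // mulf_neq0.
    apply: contraNN => /eqP Bil; rewrite mxE big1 // => r _.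
    case: (ltngtP r i) => [lt|lt|/val_inj->]; last by rewrite Bil mulr0.
      have [->|nz'] := eqVneq (B r l) 0; first by rewrite mulr0.
      rewrite -(IHk r (leq_trans lt leik)) in nz'.
      by rewrite (cA _ _ _ nz nz') ltnn in lt.
    by rewrite tD ?mul0r.
  (* Conversely, a pivot of [B] at (i, j) forces row [i] of [A] to be nonzero; the pivot of [A]
     there is also one of [B], hence lies in column [j]. *)
  apply/idP/idP=> [/sAB //|nz].
  have : (A *m M) i j != 0 by rewrite E DB // mulf_neq0.
  apply: contraNN => /eqP Aij; rewrite mxE big1 // => l _.
  have [->|/[dup]/sAB nz' _] := eqVneq (A i l) 0; first by rewrite mul0r.
  by rewrite -(rB _ _ _ nz nz') Aij mul0r.
move=> i j; have := supp i.+1 i (ltnSn i) j.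
have [->|nz] := eqVneq (A i j) 0; have [->|nz'] := eqVneq (B i j) 0 => //.
  by rewrite mul0r mulr0.
by rewrite -AM // E DB.
Qed.

(** The unit group is cyclic, and nonsquares are odd powers of a generator, so the exponents add up
    to an even number. *)
Lemma nonsquare_mul (F : finFieldType) (a b : F) : a != 0 -> b != 0 ->
    (forall u, u ^+ 2 <> a) -> (forall u, u ^+ 2 <> b) ->
  exists u, u ^+ 2 = a * b.
Proof.
rewrite -!unitfE => Ua Ub nsa nsb.
have /cyclicP[g defG] := field_unit_group_cyclic [set: {unit F}].
have gen c : c \is a GRing.unit -> exists i, c = val g ^+ i.
  move=> Uc; have : FinRing.unit F Uc \in <[g]>%g by rewrite -defG inE.
  by case/cycleP=> i /(congr1 val) /= ->; exists i; rewrite FinRing.val_unitX.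
have [[i ai] [j bj]] := (gen a Ua, gen b Ub).
have odd_exp k c : c = val g ^+ k -> (forall u, u ^+ 2 <> c) -> odd k.
  move=> -> ns; apply/negPn/negP => evk; apply: (ns (val g ^+ k./2)).
  by rewrite -exprM muln2 even_halfK.
have eij : ~~ odd (i + j) by rewrite oddD (odd_exp i a) // (odd_exp j b).
by exists (val g ^+ (i + j)./2); rewrite -exprM muln2 even_halfK // ai bj exprD.
Qed.

(** * Explicit 3 x 3 matrices *)

Lemma ord3_ind (P : 'I_3 -> Prop) :
  P (inord 0) -> P (inord 1) -> P (inord 2%N) -> forall i, P i.
Proof.
move=> P0 P1 P2 i; rewrite -(inord_val i).
by case: i => [[|[|[|]]]].
Qed.

Definition mx3 (R : pzSemiRingType) (a b c d e f g h i : R) : 'M[R]_3 :=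
  \matrix_(r, s)
    nth 0 (nth [::] [:: [:: a; b; c]; [:: d; e; f]; [:: g; h; i]] r) s.

Lemma mx3P (R : pzSemiRingType) (P : 'I_3 -> 'I_3 -> R -> Prop)
    (a b c d e f g h i : R) :
    P (inord 0) (inord 0) a -> P (inord 0) (inord 1) b ->
    P (inord 0) (inord 2%N) c -> P (inord 1) (inord 0) d ->
    P (inord 1) (inord 1) e -> P (inord 1) (inord 2%N) f ->
    P (inord 2%N) (inord 0) g -> P (inord 2%N) (inord 1) h ->
    P (inord 2%N) (inord 2%N) i ->
  forall r s, P r s (mx3 a b c d e f g h i r s).
Proof.
move=> h1 h2 h3 h4 h5 h6 h7 h8 h9 r s.
by elim/ord3_ind: r; elim/ord3_ind: s; rewrite mxE !inordK. Qed.

Lemma mx3_eta (R : pzSemiRingType) (A : 'M[R]_3) :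
  let a i j := A (inord i) (inord j) in
  A = mx3 (a 0 0)%N (a 0 1)%N (a 0 2)%N (a 1 0)%N (a 1 1)%N (a 1 2)%N
          (a 2 0)%N (a 2 1)%N (a 2 2)%N.
Proof.
move=> a; apply/matrixP=> i j; apply: esym.
exact: (mx3P (P := fun r s x => x = A r s)).
Qed.

Lemma mx3D (R : pzSemiRingType) (a b c d e f g h i : R)
    (a' b' c' d' e' f' g' h' i' : R) :
  mx3 a b c d e f g h i + mx3 a' b' c' d' e' f' g' h' i' =
  mx3 (a + a') (b + b') (c + c') (d + d') (e + e') (f + f')
      (g + g') (h + h') (i + i').
Proof.
apply/matrixP=> r s; rewrite mxE; elim/ord3_ind: r; elim/ord3_ind: s;
  by rewrite !mxE !inordK.
Qed.

Lemma mx3Z (R : pzSemiRingType) (k a b c d e f g h i : R) :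
  k *: mx3 a b c d e f g h i =
  mx3 (k * a) (k * b) (k * c) (k * d) (k * e) (k * f) (k * g) (k * h) (k * i).
Proof.
apply/matrixP=> r s; rewrite mxE; elim/ord3_ind: r; elim/ord3_ind: s;
  by rewrite !mxE !inordK.
Qed.

Lemma mx3_0 (R : pzSemiRingType) : mx3 0 0 0 0 0 0 0 0 (0 : R) = 0.
Proof.
by apply/matrixP; apply: (mx3P (P := fun r s x => x = _ r s)); rewrite mxE.
Qed.

Lemma e_mx3 (p i j : nat) : (i.-1 < 3)%N -> (j.-1 < 3)%N ->
  let b r s := ((r == i.-1) && (s == j.-1))%:R in
  e_ p i j = mx3 (b 0 0)%N (b 0 1)%N (b 0 2)%N (b 1 0)%N (b 1 1)%N (b 1 2)%N
                 (b 2 0)%N (b 2 1)%N (b 2 2)%N.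
Proof.
move=> i3 j3 b; rewrite [LHS]mx3_eta /b.
by rewrite /e_ !mxE -!val_eqE /= !inordK.
Qed.

Variant row_monomial_spec (R : pzSemiRingType) : R -> R -> R -> Prop :=
| RowZero : row_monomial_spec 0 0 0
| RowFst a : a != 0 -> row_monomial_spec a 0 0
| RowSnd a : a != 0 -> row_monomial_spec 0 a 0
| RowTrd a : a != 0 -> row_monomial_spec 0 0 a.

Lemma row_monomialP (F : fieldType) (A : 'M[F]_3) (i : 'I_3) :
    partial_monomial A ->
  row_monomial_spec (A i (inord 0)) (A i (inord 1)) (A i (inord 2%N)).
Proof.
move=> [rA _].
have z j l : A i j != 0 -> j != l -> A i l = 0.
  by move=> nz; apply: contraNeq => nz'; apply/eqP/(rA i).
have nei k l : (k < 3)%N -> (l < 3)%N -> (k != l) -> inord k != inord l :> 'I_3.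
  by move=> k3 l3; rewrite -val_eqE /= !inordK.
have [a0|nz] := eqVneq (A i (inord 0)) 0; last first.
  by rewrite (z _ (inord 1) nz) ?(z _ (inord 2%N) nz) ?nei //; exact: RowFst.
have [a1|nz] := eqVneq (A i (inord 1)) 0; last first.
  by rewrite a0 (z _ (inord 2%N) nz) ?nei //; exact: RowSnd.
have [a2|nz] := eqVneq (A i (inord 2%N)) 0; last by rewrite a0 a1; exact: RowTrd.
by rewrite a0 a1 a2; exact: RowZero.
Qed.

Definition low3 (R : pzSemiRingType) (x y z d e f : R) : 'M[R]_3 :=
  mx3 x 0 0 d y 0 e f z.

(* The adjugate matrix of [low3 x y z d e f]. *)
Definition adj_low3 (R : pzRingType) (x y z d e f : R) : 'M[R]_3 :=
  low3 (y * z) (x * z) (x * y) (- (z * d)) (d * f - y * e) (- (x * f)).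

Lemma mulmx3 (R : pzSemiRingType) (a b c d e f g h i : R) (n : nat)
    (A : 'M[R]_(3, n)) :
  mx3 a b c d e f g h i *m A =
  \matrix_(r, s) nth 0 [::
    a * A (inord 0%N) s + b * A (inord 1%N) s + c * A (inord 2%N) s;
    d * A (inord 0%N) s + e * A (inord 1%N) s + f * A (inord 2%N) s;
    g * A (inord 0%N) s + h * A (inord 1%N) s + i * A (inord 2%N) s] r.
Proof.
apply/matrixP=> r s; rewrite mxE !big_ord_recl big_ord0 addr0 addrA.
have -> : ord0 = inord 0 :> 'I_3 by apply: val_inj; rewrite /= inordK.
have -> : lift (inord 0) ord0 = inord 1 :> 'I_3.
  by apply: val_inj; rewrite /= /bump !inordK.
have -> : lift (inord 0) (lift ord0 ord0) = inord 2 :> 'I_3.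
  by apply: val_inj; rewrite /= /bump !inordK.
by elim/ord3_ind: r; rewrite !mxE !inordK.
Qed.

Lemma low3_adj (R : comPzRingType) (x y z d e f : R) :
  low3 x y z d e f *m adj_low3 x y z d e f = (x * y * z)%:M.
Proof.
rewrite mulmx3; apply/matrixP=> r s; rewrite [LHS]mxE [RHS]mxE.
by elim/ord3_ind: r; elim/ord3_ind: s; rewrite !mxE -val_eqE /= !inordK //=; ring.
Qed.

Lemma low3_trig (R : pzSemiRingType) (x y z d e f : R) (i j : 'I_3) :
  (i < j)%N -> low3 x y z d e f i j = 0.
Proof. by elim/ord3_ind: i; elim/ord3_ind: j; rewrite mxE !inordK. Qed.

Lemma low3_diag (R : pzSemiRingType) (x y z d e f : R) (i : 'I_3) :
  low3 x y z d e f i i = nth 0 [:: x; y; z] i.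
Proof. by elim/ord3_ind: i; rewrite mxE !inordK. Qed.

Lemma low3_exists (R : pzSemiRingType) (A : 'M[R]_3) (x y z : R) :
    (forall i j : 'I_3, (i < j)%N -> A i j = 0) ->
    (forall i, A i i = nth 0 [:: x; y; z] i) ->
  exists d e f, A = low3 x y z d e f.
Proof.
move=> tA dA; have a01 : A (inord 0%N) (inord 1%N) = 0 by rewrite tA ?inordK.
have a02 : A (inord 0%N) (inord 2%N) = 0 by rewrite tA ?inordK.
have a12 : A (inord 1%N) (inord 2%N) = 0 by rewrite tA ?inordK.
exists (A (inord 1%N) (inord 0%N)), (A (inord 2%N) (inord 0%N)).
exists (A (inord 2%N) (inord 1%N)).
by rewrite [LHS]mx3_eta a01 a02 a12 !dA !inordK.
Qed.

(** * Existence and uniqueness of canonical representatives over the prime field *)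

Section CanonicalForm.

Variables (p : nat) (eta : 'F_p).
Hypotheses (p_pr : prime p) (eta_nonres : odd p -> nonresidue eta).

(** If r is a square, nu = 1 works. Otherwise, for odd p, eta * r is some u ^+ 2, so r = eta * (u /
    eta) ^+ 2. For p = 2 every element is its own square. *)
Lemma nu_exists (r : 'F_p) : r != 0 ->
  exists x nu, [/\ x != 0, is_nu eta nu & r = nu * x ^+ 2].
Proof.
move=> nz; case: (pickP [pred y | y ^+ 2 == r]) => [y /eqP yr|ns]; last first.
  have nsr u : u ^+ 2 <> r by move=> ur; have := ns u; rewrite /= ur eqxx.
  case: (boolP (odd p)) => [oddp|].
    have nse := eta_nonres oddp.
    have nze : eta != 0 by apply/eqP=> e0; apply: (nse 0); rewrite e0 expr0n.
    have [u ur] := nonsquare_mul nze nz nse nsr.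
    exists (u / eta), eta; split; last by rewrite expr_div_n ur; field.
      rewrite mulf_neq0 ?invr_eq0 //; apply: contraNneq (mulf_neq0 nze nz) => u0.
      by rewrite -ur u0 expr0n.
    by right.
  case/even_prime: (p_pr) => [p2 _|-> //].
  have card2 : #|'F_p| = 2%N by rewrite card_Fp.
  by case: (nsr r); rewrite -{1}card2 expf_card.
have y0 : y != 0 by apply: contraNneq nz => y0; rewrite -yr y0 expr0n.
by exists y, 1; split=> //; [left | rewrite mul1r].
Qed.

(** If one parameter were 1 and the other eta, then eta would be the square of x or of its
    inverse. *)
Lemma nu_unique (nu nu' x : 'F_p) : is_nu eta nu -> is_nu eta nu' ->
  x != 0 -> nu' = x ^+ 2 * nu -> nu' = nu.
Proof.
move=> [->|[oddp ->]] [->|[oddp' ->]] //.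
  by move=> _; rewrite mulr1 => E; case: (eta_nonres oddp' (esym E)).
move=> nz E; case: (eta_nonres oddp (u := x^-1)).
have -> : eta = x ^- 2 * 1 by rewrite E mulKf // expf_neq0.
by rewrite mulr1 exprVn.
Qed.

(** The action of invertible diagonal matrices T by V -> T V T / det(T), with the denominator
    cleared. *)
Definition torus_orbit_canonical (V : 'M['F_p]_3) : Prop :=
  exists x y z : 'F_p, [/\ x != 0, y != 0, z != 0 &
    exists2 W, canonical_matrix eta W &
      let c (i : 'I_3) := nth 0 [:: x; y; z] i in
      forall i j, c i * c j * V i j = W i j * (x * y * z)].

Lemma torus_orbit_canonicalI (x y z : 'F_p) (W : 'M['F_p]_3)
    (a b c d e f g h i a' b' c' d' e' f' g' h' i' : 'F_p) :
    x != 0 -> y != 0 -> z != 0 -> canonical_matrix eta W ->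
    W = mx3 a' b' c' d' e' f' g' h' i' ->
    let s := x * y * z in
    [/\ x * x * a = a' * s, x * y * b = b' * s & x * z * c = c' * s] ->
    [/\ y * x * d = d' * s, y * y * e = e' * s & y * z * f = f' * s] ->
    [/\ z * x * g = g' * s, z * y * h = h' * s & z * z * i = i' * s] ->
  torus_orbit_canonical (mx3 a b c d e f g h i).
Proof.
move=> nzx nzy nzz canW defW s [Ea Eb Ec] [Ed Ee Ef] [Eg Eh Ei].
exists x, y, z; split=> //; exists W => //= r t; rewrite defW.
by elim/ord3_ind: r; elim/ord3_ind: t; rewrite !mxE !inordK.
Qed.

Ltac nonzero := by repeat
  (apply: mulf_neq0 || apply: oner_neq0 || assumption).

(* The constructor [ctor] determines the target matrix; its nine entries are found by unification
   once it is rewritten as an [mx3]. *)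
Tactic Notation "torus" uconstr(x) uconstr(y) uconstr(z) constr(ctor) :=
  refine (@torus_orbit_canonicalI x y z _ _ _ _ _ _ _ _ _ _ _ _ _ _ _ _ _ _ _
            _ _ _ ctor _ _ _ _);
  [ nonzero | nonzero | nonzero
  | by rewrite ?e_mx3 // ?mx3Z ?mx3D -?mx3_0
  | split=> /=; ring | split=> /=; ring | split=> /=; ring].

(** Replacing r by a multiple of s, instead of dividing, keeps the torus equations polynomial and
    within reach of [ring]. *)
Lemma divisor_exists (r s : 'F_p) : r != 0 -> s != 0 ->
  exists2 t, t != 0 & r = t * s.
Proof.
by move=> nzr nzs; exists (r / s); rewrite ?divfK // mulf_neq0 ?invr_eq0.
Qed.

(** Each row has one of four shapes. Of the 64 combinations, 30 put two pivots in one column; the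
    remaining 34 patterns correspond one to one to the constructors of [canonical_matrix]. *)
Lemma torus_canonical (V : 'M['F_p]_3) : partial_monomial V ->
  torus_orbit_canonical V.
Proof.
move=> mV; have [_ cV] := mV.
have col j i k : i != k -> V i j * V k j = 0.
  move=> neik; apply/eqP; rewrite mulf_eq0; apply: contraNT neik.
  by rewrite negb_or => /andP[nz nz']; apply/eqP/(cV i k j).
have nei k l : (k < 3)%N -> (l < 3)%N -> (k != l) -> inord k != inord l :> 'I_3.
  by move=> k3 l3; rewrite -val_eqE /= !inordK.
have ne01 := nei 0%N 1%N isT isT isT; have ne02 := nei 0%N 2%N isT isT isT.
have ne12 := nei 1%N 2%N isT isT isT.
have := (col (inord 0) _ _ ne01, col (inord 0) _ _ ne02,
  col (inord 0) _ _ ne12).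
have := (col (inord 1) _ _ ne01, col (inord 1) _ _ ne02,
  col (inord 1) _ _ ne12).
have := (col (inord 2%N) _ _ ne01, col (inord 2%N) _ _ ne02,
  col (inord 2%N) _ _ ne12).
rewrite [V in torus_orbit_canonical V]mx3_eta.
(* For two diagonal pivots: their ratio matters only up to squares. *)
have div_nu (r s : 'F_p) : r != 0 -> s != 0 ->
    exists x nu, [/\ x != 0, is_nu eta nu & r = nu * x ^+ 2 * s].
  move=> nzr nzs; have [t nzt ->] := divisor_exists nzr nzs.
  by have [x [nu [nzx nuP ->]]] := nu_exists nzt; exists x, nu.
case: (row_monomialP (inord 0) mV) => [|a nza|a nza|a nza];
case: (row_monomialP (inord 1) mV) => [|b nzb|b nzb|b nzb];
case: (row_monomialP (inord 2%N) mV) => [|d nzd|d nzd|d nzd];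
 move=> [[h1 h2] h3] [[h4 h5] h6] [[h7 h8] h9];
 (* Discards the combinations with two pivots in the same column. *)
 try (exfalso; match goal with
        H : (?u * ?v = 0)%R, Hu : is_true (?u != 0), Hv : is_true (?v != 0) |- _ =>
      by move/eqP: H; rewrite mulf_eq0 (negPf Hu) (negPf Hv)
    end).
(* The witnesses solve c_i c_j a = c_1 c_2 c_3. An off-diagonal pivot a becomes 1 when the third
   coordinate equals a, so a transposed pair prescribes the same coordinate twice and leaves a ratio
   t. A diagonal pivot a at i becomes 1 when the product of the other two coordinates is a c_i.
   Coordinates left free are set to 1. *)
- torus 1 1 1 (C10 eta).
- torus 1 d 1 (C9 eta).
- torus d 1 1 (C8 eta).
- torus d 1 1 (C7 eta).
- torus 1 1 b (C4 eta).
- torus d 1 b (B12 eta).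
- torus (b * d) 1 b (B11 eta).
- torus b 1 1 (C5 eta).
- torus (b * d) d 1 (B9 eta).
- have [y [nu [nzy nuP ->]]] := div_nu _ _ nzd nzb.
  torus (b * y) y 1 (B17 nuP).
- torus b 1 1 (C6 eta).
- torus b d 1 (B10 eta).
- have [t nzt ->] := divisor_exists nzd nzb; torus b 1 1 (B18 eta nzt).
- torus 1 a 1 (C1 eta).
- torus d (a * d) 1 (B7 eta).
- have [y [nu [nzy nuP ->]]] := div_nu _ _ nzd nza.
  torus y (a * y) 1 (B6 nuP).
- have [y [nu [nzy nuP ->]]] := div_nu _ _ nzb nza.
  torus y 1 (a * y) (B1 nuP).
- have [x [nu [nzx nuP ->]]] := div_nu _ _ nzb nza.
  have [y [nu' [nzy nuP' ->]]] := div_nu _ _ nzd nza.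
  torus (a * x * y) (a * y) (a * x) (A1 nuP nuP').
- torus b (a * b) 1 (B2 eta).
- have [t nzt ->] := divisor_exists nzd nzb; torus b (a * b) 1 (A2 eta nzt).
- torus 1 1 a (C2 eta).
- torus 1 d a (B13 eta).
- torus (a * d) 1 a (B8 eta).
- have [t nzt ->] := divisor_exists nza nzb; torus 1 1 b (B16 eta nzt).
- have [t nzt ->] := divisor_exists nza nzb; torus (b * d) 1 b (A6 eta nzt).
- torus b 1 a (B4 eta).
- torus b d a (A5 eta).
- torus 1 a 1 (C3 eta).
- have [t nzt ->] := divisor_exists nza nzd; torus 1 d 1 (B14 eta nzt).
- torus d a 1 (B5 eta).
- torus 1 a b (B15 eta).
- torus d a b (A4 eta).
- torus (a * b) a 1 (B3 eta).
- have [t nzt ->] := divisor_exists nza nzd; torus (b * d) d 1 (A3 eta nzt).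
Qed.

(** Holds exactly for 0 and 1; in this form such an entry is recovered from its vanishing alone. *)
Definition unit_entry (a : 'F_p) : Prop := a = (a != 0)%:R.

(* An entry of a canonical matrix can differ from 0 and 1 only at (1,2), (1,3)
   and (3,2), if the transposed entry does not vanish, and on the diagonal, if
   an earlier diagonal entry does not vanish. *)
Variant normalized (a b c d e f g h i : 'F_p) : Prop := Normalized :
    [/\ a * b = 0, a * c = 0 & b * c = 0] ->
    [/\ d * e = 0, d * f = 0 & e * f = 0] ->
    [/\ g * h = 0, g * i = 0 & h * i = 0] ->
    [/\ a * d = 0, a * g = 0 & d * g = 0] ->
    [/\ b * e = 0, b * h = 0 & e * h = 0] ->
    [/\ c * f = 0, c * i = 0 & f * i = 0] ->
    [/\ unit_entry a, unit_entry d, unit_entry f & unit_entry g] ->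
    [/\ d = 0 -> unit_entry b, g = 0 -> unit_entry c & f = 0 -> unit_entry h] ->
    (a = 0 -> unit_entry e) -> (a = 0 -> e = 0 -> unit_entry i) ->
    (a != 0 -> e != 0 -> is_nu eta e) ->
    ((a != 0) || (e != 0) -> i != 0 -> is_nu eta i) ->
  normalized a b c d e f g h i.

Definition normalized_mx (W : 'M['F_p]_3) : Prop :=
  let w i j := W (inord i) (inord j) in
  normalized (w 0 0)%N (w 0 1)%N (w 0 2)%N (w 1 0)%N (w 1 1)%N (w 1 2)%N
             (w 2 0)%N (w 2 1)%N (w 2 2)%N.

Lemma normalized_mx3 a b c d e f g h i :
  normalized a b c d e f g h i -> normalized_mx (mx3 a b c d e f g h i).
Proof. by rewrite /normalized_mx !mxE !inordK. Qed.

(** Uniqueness is derived from [normalized] alone, which avoids comparing the 34 constructors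
    pairwise. *)
Lemma canonical_normalized W : canonical_matrix eta W -> normalized_mx W.
Proof.
have U0 : unit_entry 0 by rewrite /unit_entry eqxx.
have U1 : unit_entry 1 by rewrite /unit_entry oner_eq0.
have z : (0 != 0 :> 'F_p) = false by rewrite eqxx.
have c10 : (1 = 0 :> 'F_p) -> False by move/eqP; rewrite oner_eq0.
case=> *; rewrite ?e_mx3 // ?mx3Z ?mx3D -?mx3_0 /=; apply: normalized_mx3;
  rewrite ?(mulr0, mulr1, add0r, addr0);
  split=> //; rewrite ?z ?(mulr0, mul0r) //; split=> //.
Qed.

Lemma normalized_partial_monomial W : normalized_mx W -> partial_monomial W.
Proof.
move=> [[? ? ?] [? ? ?] [? ? ?] [? ? ?] [? ? ?] [? ? ?] _ _ _ _ _ _].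
split=> i j l nz nz'; apply/eqP; apply: contraT => ne.
  have: W i j * W i l = 0.
    move: ne {nz nz'}; elim/ord3_ind: i; elim/ord3_ind: j; elim/ord3_ind: l;
      by rewrite ?eqxx // => _; rewrite mulrC.
  by move/eqP; rewrite mulf_eq0 (negPf nz) (negPf nz').
have: W i l * W j l = 0.
  move: ne {nz nz'}; elim/ord3_ind: i; elim/ord3_ind: j; elim/ord3_ind: l;
    by rewrite ?eqxx // => _; rewrite mulrC.
by move/eqP; rewrite mulf_eq0 (negPf nz) (negPf nz').
Qed.

Lemma unit_entry_inj (a b : 'F_p) :
  (a == 0) = (b == 0) -> unit_entry a -> unit_entry b -> a = b.
Proof. by rewrite /unit_entry => Z Ea Eb; rewrite [LHS]Ea [RHS]Eb Z. Qed.

(** The torus preserves supports, so entries that are 0 or 1 agree. Transposed positions are scaled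
    by the same factor, which is 1 as soon as one of the two entries is known to agree and is
    nonzero. Once a nonzero diagonal entry agrees, its factor is 1 as well, and the later diagonal
    entries are scaled by squares, where [nu_unique] applies. *)
Lemma canonical_torus_inj (x y z : 'F_p) (V W : 'M['F_p]_3) :
    x != 0 -> y != 0 -> z != 0 ->
    canonical_matrix eta V -> canonical_matrix eta W ->
    (let c (i : 'I_3) := nth 0 [:: x; y; z] i in
     forall i j, c i * c j * V i j = W i j * (x * y * z)) ->
  V = W.
Proof.
move=> nzx nzy nzz /canonical_normalized nV /canonical_normalized nW E.
have nzs : x * y * z != 0 by rewrite !mulf_neq0.
have {}E i j :
    (i < 3)%N -> (j < 3)%N ->
    (V (inord i) (inord j) == 0) = (W (inord i) (inord j) == 0) /\
    nth 0 [:: x; y; z] i * nth 0 [:: x; y; z] j * V (inord i) (inord j) =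
    W (inord i) (inord j) * (x * y * z).
  move=> i3 j3; have := E (inord i) (inord j); rewrite /= !inordK // => Eij.
  split=> //; have nzc k : (k < 3)%N -> nth 0 [:: x; y; z] k != 0.
    by case: k => [|[|[|]]].
  have := congr1 (fun u => u == 0) Eij.
  rewrite !mulf_eq0 (negPf nzx) (negPf nzy) (negPf nzz).
  by rewrite (negPf (nzc i i3)) (negPf (nzc j j3)) !orbF.
rewrite [LHS]mx3_eta [RHS]mx3_eta.
have := (E 0 0 isT isT, E 0 1 isT isT, E 0 2 isT isT)%N.
have := (E 1 0 isT isT, E 1 1 isT isT, E 1 2 isT isT)%N.
have := (E 2 0 isT isT, E 2 1 isT isT, E 2 2 isT isT)%N.
move: nV nW; rewrite /normalized_mx {E} /=.
move: (V (inord 0%N) (inord 0%N)) (V (inord 0%N) (inord 1%N))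
  (V (inord 0%N) (inord 2%N)).
move: (V (inord 1%N) (inord 0%N)) (V (inord 1%N) (inord 1%N))
  (V (inord 1%N) (inord 2%N)).
move: (V (inord 2%N) (inord 0%N)) (V (inord 2%N) (inord 1%N))
  (V (inord 2%N) (inord 2%N)).
move: (W (inord 0%N) (inord 0%N)) (W (inord 0%N) (inord 1%N))
  (W (inord 0%N) (inord 2%N)).
move: (W (inord 1%N) (inord 0%N)) (W (inord 1%N) (inord 1%N))
  (W (inord 1%N) (inord 2%N)).
move: (W (inord 2%N) (inord 0%N)) (W (inord 2%N) (inord 1%N))
  (W (inord 2%N) (inord 2%N)).
clear V W => g' h' i' d' e' f' a' b' c' g h i d e f a b c.
case=> _ _ _ _ _ _ [Ua Ud Uf Ug] [Ub Uc Uh] Ue Ui Ne Ni.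
case=> _ _ _ _ _ _ [Ua' Ud' Uf' Ug'] [Ub' Uc' Uh'] Ue' Ui' Ne' Ni'.
move=> [[[Zg Eg] [Zh Eh]] [Zi Ei]] [[[Zd Ed] [Ze Ee]] [Zf Ef]]
  [[[Za Ea] [Zb Eb]] [Zc Ec]].
have eqa : a = a' by apply: unit_entry_inj.
have eqd : d = d' by apply: unit_entry_inj.
have eqf : f = f' by apply: unit_entry_inj.
have eqg : g = g' by apply: unit_entry_inj.
subst a' d' f' g'.
have scale (u k : 'F_p) : u != 0 -> k * u = u * (x * y * z) -> x * y * z = k.
  by move=> nzu; rewrite mulrC => /(mulfI nzu).
have transp (u k v v' : 'F_p) :
    (u = 0 -> unit_entry v) -> (u = 0 -> unit_entry v') ->
    (v == 0) = (v' == 0) -> k * u = u * (x * y * z) ->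
    k * v = v' * (x * y * z) -> v = v'.
  move=> Uv Uv' Zv Eu Ev; have [u0|nzu] := eqVneq u 0.
    by apply: unit_entry_inj => //; [apply: Uv | apply: Uv'].
  have sk := scale _ k nzu Eu; rewrite sk mulrC in Ev; apply: (mulIf _ Ev).
  by rewrite -sk.
have eqb : b = b' by apply: (transp d (x * y)) => //; rewrite -Ed; ring.
have eqc : c = c' by apply: (transp g (x * z)) => //; rewrite -Eg; ring.
have eqh : h = h' by apply: (transp f (z * y)) => //; rewrite -Ef; ring.
subst b' c' h'.
(* Here k is the coordinate of an earlier nonzero diagonal entry, so [v] and [v'] differ by the
   square of k' / k. *)
have nu_inj k k' v v' : k != 0 -> k' != 0 -> x * y * z = k * k ->
    k' * k' * v = v' * (x * y * z) -> (v == 0) = (v' == 0) ->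
    (v != 0 -> is_nu eta v) -> (v' != 0 -> is_nu eta v') -> v = v'.
  move=> nzk nzk' -> Ev Zv Nv Nv'; have [v0|nzv] := eqVneq v 0.
    by move: Zv; rewrite v0 eqxx => /esym/eqP.
  have nzv' : v' != 0 by rewrite -Zv.
  apply/esym; apply: (nu_unique (x := k' / k)) (Nv nzv) (Nv' nzv') _ _.
    by rewrite mulf_neq0 ?invr_eq0.
  rewrite expr_div_n mulrAC expr2 Ev mulfK //.
  by rewrite mulf_neq0.
have eqe : e = e'.
  have [a0|nza] := eqVneq a 0; first exact: unit_entry_inj (Ue a0) (Ue' a0).
  apply: (nu_inj x y) => //; [exact: (scale a) | exact: Ne | exact: Ne'].
subst e'; congr mx3.
have [a0|nza] := eqVneq a 0; last first.
  apply: (nu_inj x z) => //; [exact: (scale a) | |]; [apply: Ni | apply: Ni'];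
    by rewrite nza.
have [e0|nze] := eqVneq e 0; first exact: unit_entry_inj (Ui a0 e0) (Ui' a0 e0).
apply: (nu_inj y z) => //; [exact: (scale e) | |]; [apply: Ni | apply: Ni'];
  by rewrite nze orbT.
Qed.

(** Eliminate with unitriangular D and L, then multiply on both sides by the diagonal matrix T found
    for the resulting pattern. Now T D and L T have the same diagonal and det(T) V = T D W L T;
    multiplying by the adjugate of L T and cancelling det(T) gives the relation. *)
Lemma canonical_representative (W : 'M['F_p]_3) :
  exists2 V, canonical_matrix eta V &
    exists x y z : 'F_p, [/\ x != 0, y != 0, z != 0 &
    exists d e f d' e' f', V *m adj_low3 x y z d' e' f' = low3 x y z d e f *m W].
Proof.
have [D [L [[tD dD] [tL dL] mono]]] := unitri_partial_monomial W.
have [x [y [z [nzx nzy nzz [V canV E]]]]] := torus_canonical mono.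
exists V => //; exists x, y, z; split=> //.
pose T := mx3 x 0 0 0 y 0 0 0 z.
have tT (i j : 'I_3) : (i < j)%N -> T i j = 0 by exact: low3_trig.
have dT i : T i i = nth 0 [:: x; y; z] i by exact: low3_diag.
have [tTD dTD] := trig_mulmx_diag tT tD.
have [tLT dLT] := trig_mulmx_diag tL tT.
have [|d [e [f defD]]] := low3_exists (x := x) (y := y) (z := z) tTD.
  by move=> i; rewrite dTD dD mulr1.
have [|d' [e' [f' defL]]] := low3_exists (x := x) (y := y) (z := z) tLT.
  by move=> i; rewrite dLT dL mul1r.
exists d, e, f, d', e', f'; rewrite -defD.
have nzs : x * y * z != 0 by rewrite !mulf_neq0.
have sV : (x * y * z) *: V = T *m D *m W *m (L *m T).
  have -> : T = diag_mx (\row_i nth 0 [:: x; y; z] (nat_of_ord i)).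
    apply/matrixP=> r s; rewrite [RHS]mxE.
    by elim/ord3_ind: r; elim/ord3_ind: s; rewrite !mxE -val_eqE /= !inordK.
  have -> : forall B, B *m D *m W *m (L *m B) = B *m (D *m W *m L) *m B.
    by move=> B; rewrite !mulmxA.
  rewrite mul_mx_diag mul_diag_mx; apply/matrixP=> i j.
  rewrite mxE mulrC -E [in RHS]mxE [in RHS]mxE ![(\row__ _) _ _]mxE.
  by rewrite mulrAC.
apply: (scalerI nzs).
rewrite scalemxAl sV defL -!mulmxA low3_adj.
by rewrite !mul_mx_scalar !scalemxAr.
Qed.

(** The adjugate is lower triangular with diagonal yz, xz, xy. Comparing pivots relates V and W
    entrywise through the two diagonals; multiplied by c_j, this is the torus relation from W to
    V. *)
Lemma canonical_representative_unique (x y z d e f d' e' f' : 'F_p)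
    (V W : 'M['F_p]_3) :
    x != 0 -> y != 0 -> z != 0 ->
    canonical_matrix eta V -> canonical_matrix eta W ->
    V *m adj_low3 x y z d' e' f' = low3 x y z d e f *m W ->
  V = W.
Proof.
move=> nzx nzy nzz canV canW E.
have mono U : canonical_matrix eta U -> partial_monomial U.
  by move/canonical_normalized/normalized_partial_monomial.
have nzc a b c : a != 0 -> b != 0 -> c != 0 ->
    forall i : 'I_3, nth 0 [:: a; b; c] i != 0 :> 'F_p.
  by move=> nza nzb nzc; case=> [[|[|[|]]]].
apply/esym/(canonical_torus_inj nzx nzy nzz canW canV) => /= i j.
have := trig_partial_monomial_inj (mono V canV) (mono W canW)
  (low3_trig _ _ _ _ _ _) _ (low3_trig _ _ _ _ _ _) _ E.
move=> /(_ _ _ i j); rewrite !low3_diag => H.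
have -> : x * y * z = nth 0 [:: y * z; x * z; x * y] j * nth 0 [:: x; y; z] j.
  by elim/ord3_ind: j {H}; rewrite inordK //=; ring.
rewrite mulrA H; first by rewrite mulrAC.
  by move=> k; rewrite low3_diag nzc ?mulf_neq0.
by move=> k; rewrite low3_diag nzc.
Qed.

End CanonicalForm.

Local Close Scope ring_scope.
Local Open Scope group_scope.
Local Open Scope abelem_scope.

(** * Change of characteristic generators *)

(** Twice the binomial coefficient is a multiple of p ^ m, hence of p ^ 2. For p = 2 one factor 2 is
    cancelled, which is where m > 1 matters; for odd p the factor 2 is coprime to p. *)
Lemma dvdn_bin2_expn (p m : nat) : prime p -> (1 < m)%N ->
  (p %| 'C(p ^ m, 2))%N.
Proof.
move=> p_pr m_gt1; have p_gt0 := prime_gt0 p_pr.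
have p2_dvd : (p ^ 2 %| 2 * 'C(p ^ m, 2))%N.
  by rewrite -mul_bin_diag dvdn_mulr // dvdn_exp2l.
have [p2eq | odd_p] := even_prime p_pr.
  by move: p2_dvd; rewrite p2eq -(@dvdn_pmul2l 2 2).
rewrite -(@Gauss_dvdr p 2) ?coprimen2 //; apply: dvdn_trans p2_dvd.
exact: dvdn_exp.
Qed.

(** By counting: the product of the three cycles is Q, so its order is at most #[x] #[y] #[z], which
    is at most n1 n2 n3 = #|Q|. All inequalities are equalities, and the intersections are
    trivial. *)
Lemma dprod_cycles (rT : finGroupType) (Q : {group rT}) (x y z : rT)
    (n1 n2 n3 : nat) :
    abelian Q -> x \in Q -> y \in Q -> z \in Q -> Q \subset <<[set x; y; z]>> ->
    (0 < #[x] <= n1)%N -> (0 < #[y] <= n2)%N -> (0 < #[z] <= n3)%N ->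
    #|Q| = (n1 * n2 * n3)%N ->
  <[x]> \x <[y]> \x <[z]> = Q /\ [/\ #[x] = n1, #[y] = n2 & #[z] = n3].
Proof.
move=> cQQ Qx Qy Qz gQ /andP[x0 lex] /andP[y0 ley] /andP[z0 lez] cardQ.
have cQ u v : u \in Q -> v \in Q -> <[u]> \subset 'C(<[v]>).
  by move=> Qu Qv; apply/cents_cycle/(centsP cQQ).
have defxy : <[x]> <*> <[y]> = <[x]> * <[y]> by rewrite cent_joinEr ?cQ.
have defQ : <[x]> <*> <[y]> * <[z]> = Q.
  rewrite -cent_joinEr; last first.
    by rewrite centsC join_subG !cQ.
  apply/eqP; rewrite eqEsubset !join_subG !cycle_subG Qx Qy Qz /=.
  apply: subset_trans gQ _; rewrite gen_subG !subUset !sub1set.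
  have [sl sr] := (@joing_subl rT, @joing_subr rT).
  rewrite -!cycle_subG sr andbT.
  by rewrite (subset_trans (sl _ _) (sl _ _)) (subset_trans (sr _ _) (sl _ _)).
have le1 : (#|Q| <= #|<[x]> <*> <[y]>| * #[z])%N.
  by rewrite -{1}defQ mul_cardG leq_pmulr ?cardG_gt0.
have le2 : (#|<[x]> <*> <[y]>| <= #[x] * #[y])%N.
  by rewrite defxy mul_cardG leq_pmulr ?cardG_gt0.
have le3 : (#[x] * #[y] * #[z] <= #|Q|)%N by rewrite cardQ !leq_mul.
have eqxyz : (#[x] * #[y] * #[z] = n1 * n2 * n3)%N.
  rewrite -cardQ; apply/eqP; rewrite eqn_leq le3 (leq_trans le1) //.
  by rewrite leq_mul2r le2 orbT.
have tixy : <[x]> :&: <[y]> = 1.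
  apply: cardMg_TI; rewrite -defxy -(leq_pmul2r z0); exact: leq_trans le3 le1.
have tixyz : <[x]> <*> <[y]> :&: <[z]> = 1.
  by apply: cardMg_TI; rewrite defQ (leq_trans _ le3) // leq_mul2r le2 orbT.
split.
  rewrite (dprodEY (cQ y x Qy Qx) tixy) dprodE ?defQ //.
  by rewrite centsC join_subG !cQ.
have tight u v n k : (0 < v -> u <= n -> v <= k -> u * v = n * k -> u = n)%N.
  move=> v0 leu lev E; apply/eqP; rewrite eqn_leq leu -(leq_pmul2r v0) E.
  by rewrite leq_mul2l lev orbT.
have exy := tight _ _ _ _ z0 (leq_mul lex ley) lez eqxyz.
split; first exact: tight _ _ _ _ y0 lex ley exy.
  by apply: tight _ _ _ _ x0 ley lex _; rewrite mulnC exy mulnC.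
apply: tight _ _ _ _ _ lez (leq_mul lex ley) _; rewrite ?muln_gt0 ?x0 //.
by rewrite mulnC eqxyz mulnC.
Qed.

(** * Commutators and powers in a fixed group of the class *)

Section CharacteristicMatrix.

Variables (p m1 m2 m3 : nat).
Hypotheses (p_pr : prime p) (m21 : (m2 < m1)%N) (m32 : (m3 < m2)%N).
Hypothesis m3_gt0 : (0 < m3)%N.
Variables (gT : finGroupType) (G : {group gT}).
Hypothesis classG : group_class p m1 m2 m3 G.

Local Notation E := (G^`(1))%G.

Let pG : p.-group G. Proof. by case: classG. Qed.
Let abelE : p.-abelem E. Proof. by case: classG => _ _ _ []. Qed.
Let cardE : #|E| = (p ^ 3)%N. Proof. by case: classG => _ _ _ []. Qed.
Let ntE : E :!=: 1.
Proof. by rewrite -cardG_gt1 cardE (ltn_exp2l 0) ?prime_gt1. Qed.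

Let expE u : u \in E -> u ^+ p = 1.
Proof. by case/and3P: abelE => _ _ /exponentP; apply. Qed.

Lemma Phi_central u g : u \in 'Phi(G) -> g \in G -> commute u g.
Proof.
case: classG => _ _ sPhiZ _ _ /(subsetP sPhiZ) /centerP[_ cu] Gg.
exact: cu.
Qed.

Lemma der1_Phi u : u \in E -> u \in 'Phi(G).
Proof. by move=> Eu; rewrite (Phi_joing pG) mem_gen // inE Eu. Qed.

Lemma expp_Phi g k : g \in G -> (p %| k)%N -> g ^+ k \in 'Phi(G).
Proof.
move=> Gg /dvdnP[l ->]; rewrite (Phi_joing pG) mem_gen // inE; apply/orP; right.
by rewrite mulnC expgM groupX // -{1}(expn1 p) Mho_p_elt // (mem_p_elt pG).
Qed.

Lemma comm_der g h : g \in G -> h \in G -> [~ g, h] \in E.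
Proof. by move=> Gg Gh; rewrite mem_commg. Qed.

Lemma der1_G u : u \in E -> u \in G.
Proof. exact: (subsetP (der_sub 1 G)). Qed.

Local Notation rho := (abelem_rV abelE ntE).

(** The commutator form: an alternating bilinear map on G, trivial on Phi(G), with values in G' seen
    as a row space over the prime field. *)
Definition brho g h := rho [~ g, h].

Lemma brho_Phi u h : u \in 'Phi(G) -> h \in G -> brho u h = 0%R.
Proof.
move=> Pu Gh; rewrite /brho (_ : [~ u, h] = 1) ?morph1 //.
by apply/eqP/commgP/Phi_central.
Qed.

Lemma brho_mull g g' h : g \in G -> g' \in G -> h \in G ->
  brho (g * g') h = (brho g h + brho g' h)%R.
Proof.
move=> Gg Gg' Gh; rewrite /brho commMgJ.
have -> : [~ g, h] ^ g' = [~ g, h].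
  by rewrite conjgE (Phi_central (der1_Phi (comm_der Gg Gh)) Gg') mulKg.
by rewrite abelem_rV_M ?comm_der.
Qed.

Lemma brho_anti g h : g \in G -> h \in G -> brho h g = (- brho g h)%R.
Proof. by move=> Gg Gh; rewrite /brho -abelem_rV_V ?comm_der // invgR. Qed.

Lemma brho_expl g h k : g \in G -> h \in G ->
  brho (g ^+ k) h = (k%:R *: brho g h)%R.
Proof.
move=> Gg Gh; elim: k => [|k IHk]; first by rewrite scale0r brho_Phi ?group1.
by by rewrite expgS brho_mull ?groupX // IHk -natr1 scalerDl scale1r addrC.
Qed.

Lemma brho_mulr g h h' : g \in G -> h \in G -> h' \in G ->
  brho g (h * h') = (brho g h + brho g h')%R.
Proof.
move=> Gg Gh Gh'; rewrite -[LHS]opprK -brho_anti ?groupM // brho_mull //.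
by rewrite opprD -!brho_anti.
Qed.

Lemma brho_expr g h k : g \in G -> h \in G ->
  brho g (h ^+ k) = (k%:R *: brho g h)%R.
Proof.
move=> Gg Gh; rewrite -[LHS]opprK -brho_anti ?groupX // brho_expl //.
by rewrite -scalerN -brho_anti.
Qed.

Lemma brho_id g : brho g g = 0%R.
Proof. by rewrite /brho commgg morph1. Qed.

Definition word (a1 a2 a3 : gT) (i j k : nat) := a1 ^+ i * a2 ^+ j * a3 ^+ k.

Lemma word_in a1 a2 a3 i j k : a1 \in G -> a2 \in G -> a3 \in G ->
  word a1 a2 a3 i j k \in G.
Proof. by move=> *; rewrite !groupM ?groupX. Qed.

(** The coefficients form the cross product of the exponent vectors, which is the source of the
    cofactor matrix; [u] and [u'] are central and drop out. *)
Lemma brho_word a1 a2 a3 i j k u i' j' k' u' :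
    a1 \in G -> a2 \in G -> a3 \in G -> u \in E -> u' \in E ->
  brho (word a1 a2 a3 i j k * u) (word a1 a2 a3 i' j' k' * u') =
  ((j%:R * k'%:R - k%:R * j'%:R) *: brho a2 a3 +
   (k%:R * i'%:R - i%:R * k'%:R) *: brho a3 a1 +
   (i%:R * j'%:R - j%:R * i'%:R) *: brho a1 a2)%R.
Proof.
move=> G1 G2 G3 Eu Eu'; have [Gu Gu'] := (der1_G Eu, der1_G Eu').
have Gw i0 j0 k0 := word_in i0 j0 k0 G1 G2 G3.
have Gw' : word a1 a2 a3 i' j' k' * u' \in G by apply: groupM.
rewrite brho_mull // (brho_Phi (der1_Phi Eu)) // addr0.
rewrite brho_mulr // (brho_anti (g := u')) // (brho_Phi (der1_Phi Eu')) //.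
rewrite oppr0 addr0 /word !brho_mull ?groupM ?groupX //.
rewrite !brho_mulr ?groupM ?groupX // !brho_expl ?groupX // !brho_expr //.
rewrite !brho_id (brho_anti G2 G3) (brho_anti G3 G1) (brho_anti G1 G2).
by apply/rowP=> c; rewrite !mxE; ring.
Qed.

(** With central commutators the correction term is [~ h, g] to the power 'C(p ^ m, 2), and p
    divides this exponent. *)
Lemma expgMn_p g h m : (1 < m)%N -> g \in G -> h \in G ->
  (g * h) ^+ (p ^ m) = g ^+ (p ^ m) * h ^+ (p ^ m).
Proof.
move=> m_gt1 Gg Gh; have Ehg := comm_der Gh Gg.
have cE x : x \in G -> commute x [~ h, g].
  by move=> Gx; apply/commute_sym/Phi_central => //; apply: der1_Phi.
rewrite expMg_Rmul; [|exact: cE|exact: cE].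
have /dvdnP[l ->] := dvdn_bin2_expn p_pr m_gt1.
by rewrite mulnC expgM expE // expg1n mulg1.
Qed.

Lemma expE_dvd u k : u \in E -> (p %| k)%N -> u ^+ k = 1.
Proof. by move=> Eu /dvdnP[l ->]; rewrite mulnC expgM expE // expg1n. Qed.

(** * Characteristic generators, commutator matrices and power matrices *)

Definition rows3 (r0 r1 r2 : 'rV['F_p](E)) : 'M['F_p]_(3, 'dim E) :=
  \matrix_(i < 3) nth 0%R [:: r0; r1; r2] i.

Definition comm_mx a1 a2 a3 := rows3 (brho a2 a3) (brho a3 a1) (brho a1 a2).

Definition power_mx a1 a2 a3 :=
  rows3 (rho (a1 ^+ (p ^ m1))) (rho (a2 ^+ (p ^ m2))) (rho (a3 ^+ (p ^ m3))).

Lemma mul_mx3_rows3 a b c d e f g h i r0 r1 r2 :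
  (mx3 a b c d e f g h i *m rows3 r0 r1 r2 =
   rows3 (a *: r0 + b *: r1 + c *: r2) (d *: r0 + e *: r1 + f *: r2)
         (g *: r0 + h *: r1 + i *: r2))%R.
Proof.
rewrite mulmx3; apply/matrixP=> r s.
by elim/ord3_ind: r; rewrite !mxE !inordK //= !mxE.
Qed.

Lemma char_gens_pow a1 a2 a3 : char_gens p m1 m2 m3 G a1 a2 a3 ->
  [/\ a1 ^+ (p ^ m1) \in E, a2 ^+ (p ^ m2) \in E & a3 ^+ (p ^ m3) \in E].
Proof.
case=> [[G1 G2 G3] _ [o1 o2 o3]].
have nE x : x \in G -> x \in 'N(E) by apply: (subsetP (der_norm 1 G)).
by split; apply: coset_idr;
  rewrite ?groupX ?nE // morphX ?nE // -?o1 -?o2 -?o3 expg_order.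
Qed.

Lemma char_gens_word a1 a2 a3 g : char_gens p m1 m2 m3 G a1 a2 a3 -> g \in G ->
  exists i j k u, u \in E /\ g = word a1 a2 a3 i j k * u.
Proof.
case=> [[G1 G2 G3] defQ _] Gg.
have nE x : x \in G -> x \in 'N(E) by apply: (subsetP (der_norm 1 G)).
have : coset E g \in G / E by apply: mem_quotient.
have [[H K defH _] _ _ _] := dprodP defQ.
case/(mem_dprod defQ)=> y [z [Hy /cycleP[k defz] defg _]].
rewrite defH in Hy.
have [y1 [y2 [/cycleP[i def1] /cycleP[j def2] defy _]]] := mem_dprod defH Hy.
have Nw : word a1 a2 a3 i j k \in 'N(E) by apply: nE; apply: word_in.
exists i, j, k, ((word a1 a2 a3 i j k)^-1 * g); split; last by rewrite mulKVg.
apply: coset_idr; first by rewrite (groupM (groupVr Nw)) ?nE.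
rewrite morphM ?(groupVr Nw) ?nE // morphV //= defg defz defy def1 def2.
by rewrite /word !morphM ?groupM ?groupX ?nE // !morphX ?nE // mulVg.
Qed.

Lemma char_gens_indep a1 a2 a3 i j k : char_gens p m1 m2 m3 G a1 a2 a3 ->
    word a1 a2 a3 i j k \in E ->
  [/\ p ^ m1 %| i, p ^ m2 %| j & p ^ m3 %| k]%N.
Proof.
move=> [[G1 G2 G3] defQ [o1 o2 o3]] Ew.
have nE x : x \in G -> x \in 'N(E) by apply: (subsetP (der_norm 1 G)).
have [[H K defH defK] _ _ tiHK] := dprodP defQ.
have [_ _ _ ti12] := dprodP defH.
have := coset_id Ew; rewrite /word !morphM ?groupM ?groupX ?nE // !morphX ?nE //=.
set A1 := coset _ a1; set A2 := coset _ a2; set A3 := coset _ a3 => E1.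
have HA : A1 ^+ i * A2 ^+ j \in H.
  have [_ <- _ _] := dprodP defH.
  by apply/mulsgP; exists (A1 ^+ i) (A2 ^+ j) => //; exact: mem_cycle.
have A3k : A3 ^+ k = 1.
  apply/set1gP; rewrite -tiHK defH; apply/setIP; split; last exact: mem_cycle.
  by rewrite -[A3 ^+ k](mulKg (A1 ^+ i * A2 ^+ j)) E1 mulg1 groupV.
have A2j : A2 ^+ j = 1.
  apply/set1gP; rewrite -ti12; apply/setIP; split; last exact: mem_cycle.
  rewrite -[A2 ^+ j](mulKg (A1 ^+ i)) groupM ?groupV ?mem_cycle //.
  by move: E1; rewrite A3k mulg1 => ->; apply: group1.
have A1i : A1 ^+ i = 1 by move: E1; rewrite A3k A2j !mulg1.
by split; rewrite -?o1 -?o2 -?o3 order_dvdn ?A1i ?A2j ?A3k.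
Qed.

Let abelQ : abelian (G / E). Proof. exact: sub_der1_abelian. Qed.

Let nE x : x \in G -> x \in 'N(E).
Proof. by apply: (subsetP (der_norm 1 G)). Qed.

Lemma abelian_basis3 : exists x y z : coset_of E,
  <[x]> \x <[y]> \x <[z]> = G / E /\
  [/\ #[x] = (p ^ m1)%N, #[y] = (p ^ m2)%N & #[z] = (p ^ m3)%N].
Proof.
have [b defQ ordb] := abelian_structure abelQ.
case: classG => _ _ _ _ typeQ; rewrite typeQ in ordb.
case: b ordb defQ => [|x [|y [|z []]]] //= [ox oy oz].
rewrite !big_cons big_nil dprodg1 dprodA => defQ.
by exists x, y, z.
Qed.

Lemma card_quotient_der1 : #|G / E| = (p ^ m1 * p ^ m2 * p ^ m3)%N.
Proof.
have [x [y [z [defQ [<- <- <-]]]]] := abelian_basis3.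
rewrite -(dprod_card defQ); congr (_ * _)%N.
by have [[H K defH _] _ _ _] := dprodP defQ; rewrite defH (dprod_card defH).
Qed.

Lemma char_gens_exist : exists a1 a2 a3, char_gens p m1 m2 m3 G a1 a2 a3.
Proof.
have [x [y [z [defQ [ox oy oz]]]]] := abelian_basis3.
have lift t : t \in G / E -> exists2 a, a \in G & t = coset E a.
  by case/morphimP=> a _ Ga ->; exists a.
have [[H K defH defK] HK _ _] := dprodP defQ.
have [_ H12 _ _] := dprodP defH.
have sHQ : H \subset G / E by rewrite -HK defH mulG_subl.
have Qx : x \in G / E.
  by rewrite (subsetP sHQ) // -H12 (subsetP (mulG_subl _ _)) ?cycle_id.
have Qy : y \in G / E.
  by rewrite (subsetP sHQ) // -H12 (subsetP (mulG_subr _ _)) ?cycle_id.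
have Qz : z \in G / E by rewrite -HK defH (subsetP (mulG_subr _ _)) ?cycle_id.
have [[a1 G1 e1] [a2 G2 e2] [a3 G3 e3]] := And3 (lift x Qx) (lift y Qy) (lift z Qz).
by exists a1, a2, a3; split=> //; rewrite -e1 -e2 -e3.
Qed.

(** The powers bound the orders modulo G', and the order of G / G' leaves no room for smaller orders
    or for nontrivial intersections. *)
Lemma char_gensI a1 a2 a3 : a1 \in G -> a2 \in G -> a3 \in G ->
    a1 ^+ (p ^ m1) \in E -> a2 ^+ (p ^ m2) \in E -> a3 ^+ (p ^ m3) \in E ->
    G \subset <<[set a1; a2; a3]>> ->
  char_gens p m1 m2 m3 G a1 a2 a3.
Proof.
move=> G1 G2 G3 E1 E2 E3 sG.
have ordle a m : a \in G -> a ^+ (p ^ m) \in E ->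
    (0 < #[coset E a] <= p ^ m)%N.
  move=> Ga Ea; rewrite order_gt0 dvdn_leq ?expn_gt0 ?prime_gt0 //.
  by rewrite order_dvdn -morphX ?nE //= coset_id.
have gQ : G / E \subset <<[set coset E a1; coset E a2; coset E a3]>>.
  rewrite sub_quotient_pre ?der_norm //; apply: subset_trans sG _.
  rewrite gen_subG !subUset !sub1set !mem_morphpre ?nE //;
    by rewrite mem_gen // !inE eqxx ?orbT.
have [defQ ords] := dprod_cycles abelQ (mem_quotient _ G1) (mem_quotient _ G2)
  (mem_quotient _ G3) gQ (ordle _ _ G1 E1) (ordle _ _ G2 E2) (ordle _ _ G3 E3)
  card_quotient_der1.
by split.
Qed.

Lemma char_gens_gen a1 a2 a3 : char_gens p m1 m2 m3 G a1 a2 a3 ->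
  <<[set a1; a2; a3]>> = G.
Proof.
move=> gensa; have [[G1 G2 G3] _ _] := gensa; apply: Phi_nongen.
apply/eqP; rewrite eqEsubset join_subG Phi_sub !subUset !sub1set G1 G2 G3 /=.
apply/subsetP=> g /(char_gens_word gensa)[i [j [k [u [Eu ->]]]]].
have sX : [set a1; a2; a3] \subset 'Phi(G) <*> [set a1; a2; a3].
  exact: joing_subr.
rewrite groupM ?word_in ?(subsetP (joing_subl _ _) _ (der1_Phi Eu)) //.
by rewrite !groupM ?groupX //; apply: (subsetP sX); rewrite !inE eqxx ?orbT.
Qed.

(** By [brho_word] all commutators lie in the span of the three rows. They generate G', whose
    dimension is 3, so the three rows span the whole space and are independent. *)
Lemma comm_mx_row_free a1 a2 a3 : char_gens p m1 m2 m3 G a1 a2 a3 ->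
  row_free (comm_mx a1 a2 a3).
Proof.
move=> gensa; have [[G1 G2 G3] _ _] := gensa; set K := comm_mx a1 a2 a3.
have K1 : (brho a2 a3 <= K)%MS.
  by apply: (@eq_row_sub _ _ _ _ _ (inord 0)); apply/rowP=> j; rewrite !mxE inordK.
have K2 : (brho a3 a1 <= K)%MS.
  by apply: (@eq_row_sub _ _ _ _ _ (inord 1)); apply/rowP=> j; rewrite !mxE inordK.
have K3 : (brho a1 a2 <= K)%MS.
  by apply: (@eq_row_sub _ _ _ _ _ (inord 2)); apply/rowP=> j; rewrite !mxE inordK.
pose S := [set u in E | (rho u <= K)%MS].
have gS : group_set S.
  apply/group_setP; split=> [|u v]; first by rewrite inE group1 morph1 sub0mx.
  rewrite !inE => /andP[Eu Ku] /andP[Ev Kv].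
  by rewrite groupM // abelem_rV_M // addmx_sub.
have sES : E \subset Group gS.
  rewrite gen_subG; apply/subsetP=> _ /imset2P[g h Gg Gh ->].
  rewrite inE comm_der //= -/(brho g h).
  have [i [j [k [u [Eu ->]]]]] := char_gens_word gensa Gg.
  have [i' [j' [k' [u' [Eu' ->]]]]] := char_gens_word gensa Gh.
  by rewrite brho_word // !addmx_sub // scalemx_sub.
have fullK : row_full K.
  rewrite -sub1mx; apply/row_subP=> i.
  rewrite -(rVabelemK abelE ntE (row i 1%:M)).
  have := subsetP sES _ (mem_rVabelem abelE ntE (row i 1%:M)).
  by rewrite inE => /andP[].
by rewrite -row_leq_rank (eqnP fullK) (dim_abelemE abelE ntE) cardE pfactorK.
Qed.

Lemma rho_row_word (w : 'M['F_p]_3) i x y z : x \in E -> y \in E -> z \in E ->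
  (0 < i <= 3)%N ->
  row_word w i x y z \in E /\
  rho (row_word w i x y z) = row (inord i.-1) (w *m rows3 (rho x) (rho y) (rho z)).
Proof.
move=> Ex Ey Ez i3; rewrite /row_word; split; first by rewrite !groupM ?groupX.
rewrite !abelem_rV_M ?groupM ?groupX // !abelem_rV_X // !natr_Zp.
rewrite [in RHS](mx3_eta w) mul_mx3_rows3; apply/rowP=> s.
rewrite [RHS]mxE [RHS]mxE.
case: i i3 => [|[|[|[|]]]] // _; by rewrite /= !inordK.
Qed.

Lemma char_matrix_ofP a1 a2 a3 (w : 'M['F_p]_3) :
    char_gens p m1 m2 m3 G a1 a2 a3 ->
  char_matrix_of p m1 m2 m3 a1 a2 a3 w <->
  (w *m comm_mx a1 a2 a3)%R = power_mx a1 a2 a3.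
Proof.
move=> gensa; have [[G1 G2 G3] _ _] := gensa.
have [P1 P2 P3] := char_gens_pow gensa.
have [Ex Ey Ez] := And3 (comm_der G2 G3) (comm_der G3 G1) (comm_der G1 G2).
have rw i := @rho_row_word w i _ _ _ Ex Ey Ez.
have rowP i : (i < 3)%N -> row (inord i) (power_mx a1 a2 a3) =
    nth 0%R [:: rho (a1 ^+ (p ^ m1)); rho (a2 ^+ (p ^ m2)); rho (a3 ^+ (p ^ m3))] i.
  by move=> i3; apply/rowP=> j; rewrite !mxE inordK.
split=> [[e1 e2 e3]|eKP].
  apply/row_matrixP; apply: ord3_ind; rewrite rowP //= ?e1 ?e2 ?e3.
  - by have [_ ->] := rw 1%N isT.
  - by have [_ ->] := rw 2%N isT.
  by have [_ ->] := rw 3%N isT.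
split; apply: (abelem_rV_inj (abelE := abelE) (ntE := ntE)) => //.
- by have [] := rw 1%N isT.
- by have [_ ->] := rw 1%N isT; rewrite eKP rowP.
- by have [] := rw 2%N isT.
- by have [_ ->] := rw 2%N isT; rewrite eKP rowP.
- by have [] := rw 3%N isT.
by have [_ ->] := rw 3%N isT; rewrite eKP rowP.
Qed.

(** A generator of smaller order modulo G' contributes nothing to the power of one of larger order;
    this makes the change of power matrices lower triangular. *)
Lemma expg_above (a : gT) m m' k : a ^+ (p ^ m) \in E -> (m < m')%N ->
  (a ^+ k) ^+ (p ^ m') = 1.
Proof.
move=> Ea ltm; rewrite expgAC -(subnKC (ltnW ltm)) expnD expgM.
by rewrite (expE_dvd Ea) ?expg1n // dvdn_exp ?subn_gt0.
Qed.

Lemma expg_below (a : gT) m m' d : (m' <= m)%N ->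
  (a ^+ (p ^ (m - m') * d)) ^+ (p ^ m') = (a ^+ (p ^ m)) ^+ d.
Proof. by move=> le; rewrite -!expgM mulnAC -expnD subnK. Qed.

Lemma expg_der u m : u \in E -> (0 < m)%N -> u ^+ (p ^ m) = 1.
Proof. by move=> Eu m_gt0; rewrite (expE_dvd Eu) ?dvdn_exp. Qed.

(** * Effect of a change of generators on commutators and powers *)

Section ChangeOfGenerators.

Variables a1 a2 a3 : gT.
Hypotheses (G1 : a1 \in G) (G2 : a2 \in G) (G3 : a3 \in G).
Hypotheses (P1 : a1 ^+ (p ^ m1) \in E) (P2 : a2 ^+ (p ^ m2) \in E).
Hypothesis P3 : a3 ^+ (p ^ m3) \in E.
Variables c1 c2 c3 d21 d31 d32 e12 e13 e23 : nat.
Variables u1 u2 u3 : gT.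
Hypotheses (E1 : u1 \in E) (E2 : u2 \in E) (E3 : u3 \in E).

(** The powers of p in the exponents of [b2] and [b3] bring their p ^ m2-th and p ^ m3-th powers
    into G'. *)
Let b1 := word a1 a2 a3 c1 e12 e13 * u1.
Let b2 := word a1 a2 a3 (p ^ (m1 - m2) * d21) c2 e23 * u2.
Let b3 := word a1 a2 a3 (p ^ (m1 - m3) * d31) (p ^ (m2 - m3) * d32) c3 * u3.

Let m2_gt1 : (1 < m2)%N. Proof. exact: leq_ltn_trans m3_gt0 m32. Qed.
Let m1_gt1 : (1 < m1)%N. Proof. exact: ltn_trans m2_gt1 m21. Qed.
Let m31 : (m3 < m1)%N. Proof. exact: ltn_trans m32 m21. Qed.

Lemma change_mem : [/\ b1 \in G, b2 \in G & b3 \in G].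
Proof. by split; rewrite groupM ?word_in // der1_G. Qed.

Lemma change_pow :
  [/\ b1 ^+ (p ^ m1) = (a1 ^+ (p ^ m1)) ^+ c1,
      b2 ^+ (p ^ m2) = (a1 ^+ (p ^ m1)) ^+ d21 * (a2 ^+ (p ^ m2)) ^+ c2
    & b3 ^+ (p ^ m3) = (a1 ^+ (p ^ m1)) ^+ d31 * (a2 ^+ (p ^ m2)) ^+ d32 *
                       (a3 ^+ (p ^ m3)) ^+ c3].
Proof.
have Gu1 := der1_G E1; have Gu2 := der1_G E2; split; rewrite /b1 /b2 /b3.
- rewrite /word !expgMn_p ?groupM ?groupX //.
  rewrite (expg_above _ P2) // (expg_above _ P3) // (expg_der E1) ?(ltnW m1_gt1) //.
  by rewrite !mulg1 expgAC.
- rewrite /word !expgMn_p ?groupM ?groupX //.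
  rewrite (expg_below _ _ (ltnW m21)) (expg_above _ P3) //.
  rewrite (expg_der E2) ?(ltnW m2_gt1) //.
  by rewrite !mulg1 (expgAC a2).
(* Since m3 may be 1, [expgMn_p] cannot be used for [b3]. Instead all its factors except the power
   of [a3] are central, so its powers distribute for any exponent. *)
have Phi1 : a1 ^+ (p ^ (m1 - m3) * d31) \in 'Phi(G).
  by rewrite expp_Phi // dvdn_mulr // dvdn_exp ?subn_gt0.
have Phi2 : a2 ^+ (p ^ (m2 - m3) * d32) \in 'Phi(G).
  by rewrite expp_Phi // dvdn_mulr // dvdn_exp ?subn_gt0.
have c3u : commute (word a1 a2 a3 (p ^ (m1 - m3) * d31) (p ^ (m2 - m3) * d32) c3) u3.
  by apply/commute_sym/Phi_central; [exact: der1_Phi | exact: word_in].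
rewrite expgMn // (expg_der E3) // mulg1 /word expgMn; last first.
  by apply: Phi_central; [exact: groupM | exact: groupX].
rewrite expgMn; last by apply: Phi_central => //; exact: groupX.
by rewrite (expg_below _ _ (ltnW m31)) (expg_below _ _ (ltnW m32)) (expgAC a3).
Qed.

Let natr0 k d : (0 < k)%N -> ((p ^ k * d)%:R = 0 :> 'F_p)%R.
Proof.
move=> k_gt0; apply/eqP; rewrite -(dvdn_pcharf (pchar_Fp p_pr)).
by rewrite dvdn_mulr // dvdn_exp.
Qed.

(** Modulo p the exponents with a factor p ^ (m_i - m_j) vanish. The exponent matrix becomes upper
    triangular, and its cofactor matrix is the adjugate of its transpose. *)
Lemma change_comm_mx : comm_mx b1 b2 b3 =
  (adj_low3 c1%:R c2%:R c3%:R e12%:R e13%:R e23%:R *m comm_mx a1 a2 a3)%R.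
Proof.
rewrite /adj_low3 /low3 mul_mx3_rows3 /comm_mx !brho_word //.
rewrite !natr0 ?subn_gt0 //; apply/matrixP=> r s.
by elim/ord3_ind: r; rewrite !mxE !inordK //= !mxE; ring.
Qed.

Lemma change_power_mx : power_mx b1 b2 b3 =
  (low3 c1%:R c2%:R c3%:R d21%:R d31%:R d32%:R *m power_mx a1 a2 a3)%R.
Proof.
rewrite /power_mx; have [-> -> ->] := change_pow.
have X1 k := groupX k P1; have X2 k := groupX k P2; have X3 k := groupX k P3.
rewrite (abelem_rV_M abelE ntE (X1 d21) (X2 c2)).
rewrite (abelem_rV_M abelE ntE (groupM (X1 d31) (X2 d32)) (X3 c3)).
rewrite (abelem_rV_M abelE ntE (X1 d31) (X2 d32)).
rewrite !(abelem_rV_X abelE ntE _ P1) !(abelem_rV_X abelE ntE _ P2).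
rewrite (abelem_rV_X abelE ntE _ P3).
by rewrite /low3 mul_mx3_rows3 !scale0r !addr0.
Qed.

End ChangeOfGenerators.

Lemma root_mem (X : {group gT}) a c : a \in G -> ~~ (p %| c)%N ->
  a ^+ c \in X -> a \in X.
Proof.
move=> Ga npc Xac; have /p_natP[k oa] : p.-nat #[a] by apply: mem_p_elt pG Ga.
have : generator <[a]> (a ^+ c).
  by rewrite generator_coprime oa coprimeXl // prime_coprime.
by move/eqP => defa; rewrite -cycle_subG defa cycle_subG.
Qed.

(** Modulo Phi(G) the change is upper triangular with invertible diagonal, so [a3], [a2] and [a1]
    are recovered in this order; Phi(G) consists of nongenerators. *)
Lemma change_char_gens a1 a2 a3 c1 c2 c3 d21 d31 d32 e12 e13 e23 :
    char_gens p m1 m2 m3 G a1 a2 a3 ->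
    ~~ (p %| c1)%N -> ~~ (p %| c2)%N -> ~~ (p %| c3)%N ->
  char_gens p m1 m2 m3 G (word a1 a2 a3 c1 e12 e13 * 1)
    (word a1 a2 a3 (p ^ (m1 - m2) * d21) c2 e23 * 1)
    (word a1 a2 a3 (p ^ (m1 - m3) * d31) (p ^ (m2 - m3) * d32) c3 * 1).
Proof.
move=> gensa nc1 nc2 nc3; have [[G1 G2 G3] _ _] := gensa.
have [P1 P2 P3] := char_gens_pow gensa.
have [Q1 Q2 Q3] := change_pow G1 G2 G3 P2 P3 c1 c2 c3 d21 d31 d32 e12 e13 e23
  (group1 E) (group1 E) (group1 E).
have [H1 H2 H3] := change_mem G1 G2 G3 c1 c2 c3 d21 d31 d32 e12 e13 e23
  (group1 E) (group1 E) (group1 E).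
have X1 k := groupX k P1; have X2 k := groupX k P2; have X3 k := groupX k P3.
apply: char_gensI => //.
- by rewrite Q1 X1.
- by rewrite Q2; apply: groupM.
- by rewrite Q3; do 2!apply: groupM => //.
set b1 := word _ _ _ _ _ _ * 1 in H1 *; set b2 := word _ _ _ _ _ _ * 1 in H2 *.
set b3 := word _ _ _ _ _ _ * 1 in H3 *.
pose X := ('Phi(G) <*> [set b1; b2; b3])%G.
have sPX : 'Phi(G) \subset X by apply: joing_subl.
have sX : [set b1; b2; b3] \subset X by apply: joing_subr.
have [Xb1 Xb2 Xb3] : [/\ b1 \in X, b2 \in X & b3 \in X].
  by split; apply: (subsetP sX); rewrite !inE eqxx ?orbT.
have Phip a k d : a \in G -> (0 < k)%N -> a ^+ (p ^ k * d) \in 'Phi(G).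
  by move=> Ga k0; apply: expp_Phi => //; rewrite dvdn_mulr // dvdn_exp.
have sub_gt0 := subn_gt0; have m31 := ltn_trans m32 m21.
have Xa3 : a3 \in X.
  apply: (root_mem G3 nc3); move: Xb3.
  by rewrite /b3 mulg1 groupMl // groupM // (subsetP sPX) // Phip ?sub_gt0.
have Xa2 : a2 \in X.
  apply: (root_mem G2 nc2); move: Xb2.
  rewrite /b2 mulg1 groupMr ?(groupX _ Xa3) // groupMl //.
  by rewrite (subsetP sPX) // Phip ?sub_gt0.
have Xa1 : a1 \in X.
  apply: (root_mem G1 nc1); move: Xb1.
  by rewrite /b1 mulg1 groupMr ?(groupX _ Xa3) // groupMr ?(groupX _ Xa2).
have -> // : <<[set b1; b2; b3]>> = G.
apply: Phi_nongen; apply/eqP; rewrite eqEsubset; apply/andP; split.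
  by rewrite join_subG Phi_sub !subUset !sub1set H1 H2 H3.
rewrite -{1}(char_gens_gen gensa) gen_subG !subUset !sub1set.
by rewrite Xa1 Xa2 Xa3.
Qed.

Lemma word_pow_der1 a1 a2 a3 i j k u q : a1 \in G -> a2 \in G -> a3 \in G ->
  u \in E -> (word a1 a2 a3 i j k * u) ^+ q \in E ->
  word a1 a2 a3 (i * q) (j * q) (k * q) \in E.
Proof.
move=> G1 G2 G3 Eu; have Gw := word_in i j k G1 G2 G3; move=> /coset_id.
rewrite morphX ?(groupM (nE Gw)) ?nE ?der1_G //=.
rewrite morphM ?(nE Gw) ?nE ?der1_G //= [coset _ u]coset_id // mulg1 => E1.
have Gw' := word_in (i * q) (j * q) (k * q) G1 G2 G3.
apply: coset_idr; first exact: nE.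
have cQ x y : x \in G -> y \in G -> commute (coset E x) (coset E y).
  by move=> Gx Gy; apply: (centsP abelQ); apply: mem_quotient.
rewrite -[RHS]E1 /word !morphM ?nE ?groupM ?groupX //= !morphX ?nE //=.
have c12 : commute (coset E a1 ^+ i) (coset E a2 ^+ j).
  by apply: commuteX2; apply: cQ.
have c3 : commute (coset E a1 ^+ i * coset E a2 ^+ j) (coset E a3 ^+ k).
  by apply: commute_sym; apply: commuteM; apply: commuteX2; apply: cQ.
by rewrite !expgMn // !expgM.
Qed.

(** As the p ^ m2-th power of [b2] lies in G', p ^ m1 divides p ^ m2 times the exponent of [a1] in
    [b2], which gives the factor p ^ (m1 - m2); the exponents in [b3] are treated alike. *)
Lemma change_exists a1 a2 a3 b1 b2 b3 :
    char_gens p m1 m2 m3 G a1 a2 a3 -> char_gens p m1 m2 m3 G b1 b2 b3 ->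
  exists c1 c2 c3 d21 d31 d32 e12 e13 e23 : nat, exists u1 u2 u3 : gT,
  [/\ [/\ u1 \in E, u2 \in E & u3 \in E],
      b1 = word a1 a2 a3 c1 e12 e13 * u1,
      b2 = word a1 a2 a3 (p ^ (m1 - m2) * d21) c2 e23 * u2
    & b3 = word a1 a2 a3 (p ^ (m1 - m3) * d31) (p ^ (m2 - m3) * d32) c3 * u3].
Proof.
move=> gensa gensb; have [[G1 G2 G3] _ _] := gensa.
have [[H1 H2 H3] _ _] := gensb; have [Q1 Q2 Q3] := char_gens_pow gensb.
have [c1 [e12 [e13 [u1 [E1 b1E]]]]] := char_gens_word gensa H1.
have [i2 [c2 [e23 [u2 [E2 b2E]]]]] := char_gens_word gensa H2.
have [i3 [j3 [c3 [u3 [E3 b3E]]]]] := char_gens_word gensa H3.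
have quot m m' i : (m' < m)%N -> (p ^ m %| i * p ^ m')%N ->
    exists d, i = (p ^ (m - m') * d)%N.
  move=> lt; rewrite -{1}(subnK (ltnW lt)) expnD dvdn_pmul2r ?expn_gt0 ?prime_gt0 //.
  by case/dvdnP=> d ->; exists d; rewrite mulnC.
rewrite b2E in Q2; rewrite b3E in Q3.
have [D21 _ _] := char_gens_indep gensa (word_pow_der1 G1 G2 G3 E2 Q2).
have [D31 D32 _] := char_gens_indep gensa (word_pow_der1 G1 G2 G3 E3 Q3).
have [d21 d21E] := quot _ _ _ m21 D21; have [d32 d32E] := quot _ _ _ m32 D32.
have [d31 d31E] := quot _ _ _ (ltn_trans m32 m21) D31.
exists c1, c2, c3, d21, d31, d32, e12, e13, e23, u1, u2, u3.
by rewrite -d21E -d31E -d32E.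
Qed.

(** Let K be the commutator matrix of the first generators. Expressing the power matrix of the
    second generators in two ways gives V M K = D W K, with M the adjugate and D the lower
    triangular matrix; K is row free and cancels. *)
Lemma char_matrix_change (W V : 'M['F_p]_3) :
    char_matrix p m1 m2 m3 G W -> char_matrix p m1 m2 m3 G V ->
  exists x y z d e f d' e' f' : 'F_p, [/\ x != 0, y != 0, z != 0 &
    V *m adj_low3 x y z d' e' f' = low3 x y z d e f *m W]%R.
Proof.
move=> [a1 [a2 [a3 [gensa matW]]]] [b1 [b2 [b3 [gensb matV]]]].
have [[G1 G2 G3] _ _] := gensa; have [P1 P2 P3] := char_gens_pow gensa.
move: matW matV => /(char_matrix_ofP _ gensa) KW /(char_matrix_ofP _ gensb).
have := comm_mx_row_free gensb.
have [c1 [c2 [c3 [d21 [d31 [d32 [e12 [e13 [e23 [u1 [u2 [u3 [[E1 E2 E3]]]]]]]]]]]]]] :=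
  change_exists gensa gensb.
move=> -> -> ->; rewrite change_comm_mx // change_power_mx // -KW.
set M := adj_low3 _ _ _ _ _ _; set D := low3 _ _ _ _ _ _ => freeMK KV.
(* The new commutator matrix is row free too, so M is invertible; its diagonal entries yz, xz, xy
   are nonzero, and so are x, y, z. *)
have : row_free M.
  rewrite -row_leq_rank; apply: leq_trans (mxrankM_maxl M (comm_mx a1 a2 a3)).
  by rewrite row_leq_rank.
rewrite row_free_unit unitmxE det_trig; last first.
  by apply/is_trig_mxP => i j; apply: low3_trig.
rewrite (eq_bigr _ (fun i _ => low3_diag _ _ _ _ _ _ i)) !big_ord_recl big_ord0 /=.
rewrite unitfE !mulf_eq0 oner_eq0 orbF !negb_or /=.
case/and3P=> /andP[nzy nzz] /andP[nzx _] _.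
exists c1%:R%R, c2%:R%R, c3%:R%R, d21%:R%R, d31%:R%R, d32%:R%R.
exists e12%:R%R, e13%:R%R, e23%:R%R; split=> //.
apply: (row_free_inj (comm_mx_row_free gensa)) => /=.
by rewrite -!mulmxA -/M -/D KV.
Qed.

(** The elements of 'F_p, read as natural numbers, serve as the exponents of the new generators. *)
Lemma char_matrix_of_change (W V : 'M['F_p]_3) (x y z d e f d' e' f' : 'F_p) :
    char_matrix p m1 m2 m3 G W -> x != 0%R -> y != 0%R -> z != 0%R ->
    (V *m adj_low3 x y z d' e' f' = low3 x y z d e f *m W)%R ->
  char_matrix p m1 m2 m3 G V.
Proof.
move=> [a1 [a2 [a3 [gensa /(char_matrix_ofP _ gensa) KW]]]] nzx nzy nzz E.
have [[G1 G2 G3] _ _] := gensa; have [P1 P2 P3] := char_gens_pow gensa.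
have ndiv (c : 'F_p) : c != 0%R -> ~~ (p %| c)%N.
  by rewrite (dvdn_pcharf (pchar_Fp p_pr)) natr_Zp.
have gensb := change_char_gens d e f d' e' f' gensa
  (ndiv x nzx) (ndiv y nzy) (ndiv z nzz).
do 3!eexists; split; first exact: gensb.
apply/(char_matrix_ofP _ gensb); rewrite change_comm_mx // change_power_mx //.
by rewrite !natr_Zp mulmxA E -KW mulmxA.
Qed.

Lemma char_matrix_exists : exists W : 'M['F_p]_3, char_matrix p m1 m2 m3 G W.
Proof.
have [a1 [a2 [a3 gensa]]] := char_gens_exist.
(* The commutator matrix is square and row free, so its row space is everything. *)
have : (power_mx a1 a2 a3 <= comm_mx a1 a2 a3)%MS.
  apply: submx_full; rewrite -col_leq_rank (eqnP (comm_mx_row_free gensa)).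
  by rewrite (dim_abelemE abelE ntE) cardE pfactorK.
case/submxP=> W defW; exists W, a1, a2, a3; split=> //.
exact/(char_matrix_ofP _ gensa).
Qed.

End CharacteristicMatrix.

(** * Transport along isomorphisms and the classification *)

Lemma char_matrix_isog (p m1 m2 m3 : nat) (gT hT : finGroupType)
    (G : {group gT}) (H : {group hT}) (v : 'M['F_p]_3) :
    prime p -> group_class p m1 m2 m3 G -> group_class p m1 m2 m3 H ->
    H \isog G ->
  char_matrix p m1 m2 m3 H v -> char_matrix p m1 m2 m3 G v.
Proof.
move=> p_pr classG classH /isogP[f injf defG] [a1 [a2 [a3 [gensa [M1 M2 M3]]]]].
have [[H1 H2 H3] _ _] := gensa.
have fG x : x \in H -> f x \in G by move=> Hx; rewrite -defG mem_morphim.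
have fG' x : x \in H^`(1) -> f x \in G^`(1).
  move=> H'x; rewrite -defG -morphim_der // mem_morphim //.
  exact: (subsetP (der_sub 1 H)).
have f_row i x y z : x \in H -> y \in H -> z \in H ->
    f (row_word v i x y z) = row_word v i (f x) (f y) (f z).
  by move=> Hx Hy Hz; rewrite /row_word !morphM ?groupM ?groupX // !morphX.
have [E1 E2 E3] := char_gens_pow gensa.
exists (f a1), (f a2), (f a3); split; last first.
  by split; rewrite -morphX // ?M1 ?M2 ?M3 f_row ?groupR // !morphR.
(* By this criterion only the powers and the generation of G need to be carried along [f], not the
   direct decomposition of the quotient. *)
apply: char_gensI => //; try exact: fG; rewrite -?morphX ?fG' //.
have -> : G :=: f @* <<[set a1; a2; a3]>>.
  by rewrite (char_gens_gen classH gensa) defG.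
rewrite morphim_gen; last first.
  by rewrite !subUset !sub1set H1 H2 H3.
apply: genS; apply/subsetP=> _ /morphimP[x _ + ->].
by rewrite !inE => /orP[/orP[]|] /eqP->; rewrite eqxx ?orbT.
Qed.

Theorem theorem3p1 (p m1 m2 m3 : nat) (eta : 'F_p)
    (p_pr : prime p) (eta_nonres : odd p -> nonresidue eta)
    (m21 : m2 < m1) (m32 : m3 < m2) (m3_gt0 : 0 < m3) :
  (forall (gT : finGroupType) (G : {group gT}),
     group_class p m1 m2 m3 G ->
     exists2 w : 'M['F_p]_3,
       canonical_matrix eta w & char_matrix p m1 m2 m3 G w)
  /\
  (forall (gT hT : finGroupType) (G : {group gT}) (H : {group hT})
          (w v : 'M['F_p]_3),
     group_class p m1 m2 m3 G -> group_class p m1 m2 m3 H ->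
     canonical_matrix eta w -> canonical_matrix eta v ->
     char_matrix p m1 m2 m3 G w -> char_matrix p m1 m2 m3 H v ->
     w <> v -> ~ (G \isog H)%g).
Proof.
split=> [gT G classG | gT hT G H w v classG classH canw canv matw matv neq isoGH].
  have [W matW] := char_matrix_exists p_pr classG.
  have [V canV [x [y [z [nzx nzy nzz [d [e [f [d' [e' [f' E]]]]]]]]]]] :=
    canonical_representative p_pr eta_nonres W.
  by exists V => //; apply: char_matrix_of_change matW nzx nzy nzz E.
(* Along an isomorphism [v] becomes a second characteristic matrix of G, to be compared with [w]
   inside one group. *)
have matGv : char_matrix p m1 m2 m3 G v.
  by apply: char_matrix_isog matv => //; rewrite isog_sym.
have [x [y [z [d [e [f [d' [e' [f' [nzx nzy nzz E]]]]]]]]]] :=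
  char_matrix_change p_pr m21 m32 m3_gt0 classG matw matGv.
apply: neq; apply: esym.
exact: (canonical_representative_unique eta_nonres nzx nzy nzz canv canw E).
Qed.
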